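(* Let $\mathbf{k}$ be a commutative $\mathbb{Q}$-algebra and $N\geq 1$ an integer. The diagram of graded algebra morphisms with top arrow $\Delta^{\mathcal{W},\mathrm{DR}}_N:\mathcal{W}^{\mathrm{DR}}_N\to\mathcal{W}^{\mathrm{DR}}_N\otimes\mathcal{W}^{\mathrm{DR}}_N$, bottom arrow $\mathrm{gr}(\Delta^{\mathcal{W},\mathrm{B}}):\mathrm{gr}(\mathcal{W}^{\mathrm{B}}_N)\to\mathrm{gr}(\mathcal{W}^{\mathrm{B}}_N)\otimes\mathrm{gr}(\mathcal{W}^{\mathrm{B}}_N)$, and vertical arrows $\rho^{\mathcal{W}}_N$ (left) and $\rho^{\mathcal{W}}_N\otimes\rho^{\mathcal{W}}_N$ (right) commutes, i.e. $$\mathrm{gr}(\Delta^{\mathcal{W},\mathrm{B}})\circ\rho^{\mathcal{W}}_N=(\rho^{\mathcal{W}}_N\otimes\rho^{\mathcal{W}}_N)\circ\Delta^{\mathcal{W},\mathrm{DR}}_N .$$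
   Context: Products of submodules: for $\mathbf{k}$-submodules $A_1,\dots,A_k$ of a $\mathbf{k}$-algebra $A$ and positive integers $n_1,\dots,n_k$, $A_1^{n_1}\cdots A_k^{n_k}$ denotes the image of $A_1^{\otimes n_1}\otimes\cdots\otimes A_k^{\otimes n_k}\to A$ induced by the product (i.e. the $\mathbf{k}$-span of products). Tensor products are over $\mathbf{k}$. Betti side. Let $\mu_N$ be the group of complex $N$-th roots of unity, $\zeta_N=e^{2\pi \mathrm{i}/N}$. Let $F_2$ be the free group on $X_0,X_1$ and $F_2\to\mu_N$ the group morphism $X_0\mapsto\zeta_N$, $X_1\mapsto 1$. Let $\mathcal{I}_N:=\ker(\mathbf{k}F_2\to\mathbf{k}\mu_N)$ be the kernel of the induced group algebra morphism. $\mathcal{V}^{\mathrm{B}}_N$ is the group algebra $\mathbf{k}F_2$ with the decreasing algebra filtration $\mathcal{F}^m\mathcal{V}^{\mathrm{B}}_N=\mathbf{k}F_2$ for $m\le 0$ and $\mathcal{F}^m\mathcal{V}^{\mathrm{B}}_N=\mathcal{I}_N^m$ for $m>0$. $\mathcal{W}^{\mathrm{B}}_N:=\mathbf{k}\oplus\mathcal{V}^{\mathrm{B}}_N(X_1-1)$ is a subalgebra, with algebra filtration $\mathcal{F}^m\mathcal{W}^{\mathrm{B}}_N:=\mathcal{W}^{\mathrm{B}}_N\cap\mathcal{F}^m\mathcal{V}^{\mathrm{B}}_N$. As an algebra it does not depend on $N$ and is denoted $\mathcal{W}^{\mathrm{B}}$. The tensor square is filtered by $\mathcal{F}^m(\mathcal{W}^{\mathrm{B}}_N\otimes\mathcal{W}^{\mathrm{B}}_N):=\sum_{i+j=m}\mathcal{F}^i\mathcal{W}^{\mathrm{B}}_N\otimes\mathcal{F}^j\mathcal{W}^{\mathrm{B}}_N$.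 Betti coproduct. It is known that $\mathcal{W}^{\mathrm{B}}$ is generated by $X_1^{-1}$ and $X_0^n(X_1-1)$, $n\in\mathbb{Z}$, and that there is a (necessarily unique) algebra morphism $\Delta^{\mathcal{W},\mathrm{B}}:\mathcal{W}^{\mathrm{B}}\to\mathcal{W}^{\mathrm{B}}\otimes\mathcal{W}^{\mathrm{B}}$, making $\mathcal{W}^{\mathrm{B}}$ a bialgebra, such that $$\Delta^{\mathcal{W},\mathrm{B}}(X_1^{-1})=X_1^{-1}Y_1^{-1},$$ $$\Delta^{\mathcal{W},\mathrm{B}}(X_0^n(X_1-1))=X_0^n(X_1-1)+Y_0^n(Y_1-1)-\sum_{k=1}^{n-1}X_0^k(X_1-1)\,Y_0^{n-k}(Y_1-1)\quad(n\in\mathbb{Z}),$$ where on the right-hand sides $X_i^{\pm1}$ stands for $X_i^{\pm1}\otimes 1$ and $Y_i^{\pm1}:=1\otimes X_i^{\pm1}$ ($i\in\{0,1\}$). Summation convention, for $p,q\in\mathbb{Z}$: $\sum_{k=p}^q f(k)$ is $f(p)+\cdots+f(q)$ if $q>p-1$, is $0$ if $q=p-1$, and is $-f(p-1)-\cdots-f(q+1)$ if $q<p-1$. One has $\Delta^{\mathcal{W},\mathrm{B}}(\mathcal{F}^m\mathcal{W}^{\mathrm{B}}_N)\subset\mathcal{F}^m(\mathcal{W}^{\mathrm{B}}_N\otimes\mathcal{W}^{\mathrm{B}}_N)$ for all $m\in\mathbb{Z}$; $\mathrm{gr}(\Delta^{\mathcal{W},\mathrm{B}})$ is the induced morphism of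 associated graded algebras, with $\mathrm{gr}(\mathcal{W}^{\mathrm{B}}_N\otimes\mathcal{W}^{\mathrm{B}}_N)$ identified with $\mathrm{gr}(\mathcal{W}^{\mathrm{B}}_N)\otimes\mathrm{gr}(\mathcal{W}^{\mathrm{B}}_N)$. Here $\mathrm{gr}(M)=\bigoplus_m\mathcal{F}^mM/\mathcal{F}^{m+1}M$. De Rham side. $\mathcal{V}^{\mathrm{DR}}_N$ is the graded $\mathbf{k}$-algebra generated by $\{e_0,e_1\}\sqcup\mu_N$, with $e_0,e_1$ of degree $1$ and elements of $\mu_N$ of degree $0$, subject to the relations: for $\zeta,\eta\in\mu_N$, the product $\zeta\cdot\eta$ in the algebra equals the generator $\zeta\eta\in\mu_N$; the generator $1\in\mu_N$ is the unit of the algebra; $\zeta\cdot e_0=e_0\cdot\zeta$. Let $\mathcal{W}^{\mathrm{DR}}_N:=\mathbf{k}\oplus\mathcal{V}^{\mathrm{DR}}_Ne_1$, a graded subalgebra, known to be freely generated by the elements $z_{n,\zeta}:=-e_0^{n-1}\zeta e_1$, $(n,\zeta)\in\mathbb{Z}_{>0}\times\mu_N$ (of degree $n$). $\Delta^{\mathcal{W},\mathrm{DR}}_N:\mathcal{W}^{\mathrm{DR}}_N\to\mathcal{W}^{\mathrm{DR}}_N\otimes\mathcal{W}^{\mathrm{DR}}_N$ is the algebra morphism with $$\Delta^{\mathcal{W},\mathrm{DR}}_N(z_{n,\zeta})=z_{n,\zeta}\otimes1+1\otimes z_{n,\zeta}+\sum_{k=1}^{n-1}\sum_{\eta\in\mu_N}z_{k,\eta}\otimes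 z_{n-k,\zeta\eta^{-1}}.$$ Comparison. For $v\in\mathcal{F}^m\mathcal{V}^{\mathrm{B}}_N$ let $[v]_m$ be its class in $\mathcal{F}^m\mathcal{V}^{\mathrm{B}}_N/\mathcal{F}^{m+1}\mathcal{V}^{\mathrm{B}}_N$. It is known that there is a unique graded algebra isomorphism $\rho^{\mathcal{V}}_N:\mathcal{V}^{\mathrm{DR}}_N\to\mathrm{gr}(\mathcal{V}^{\mathrm{B}}_N)$ with $\zeta_N\mapsto[X_0]_0$, $e_0\mapsto[X_0^N-1]_1$, $e_1\mapsto[X_1-1]_1$, and that it restricts to a graded algebra isomorphism $\rho^{\mathcal{W}}_N:\mathcal{W}^{\mathrm{DR}}_N\to\mathrm{gr}(\mathcal{W}^{\mathrm{B}}_N)$, where $\mathrm{gr}(\mathcal{W}^{\mathrm{B}}_N)\subset\mathrm{gr}(\mathcal{V}^{\mathrm{B}}_N)$. *)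

(* Defs.v *)
From HB Require Import structures.
From mathcomp Require Import all_boot all_order all_algebra finmap.
From mathcomp Require Import generic_quotient complex.
From mathcomp Require Import boolp classical_sets fsbigop reals trigo.

Set Implicit Arguments.
Unset Strict Implicit.
Unset Printing Implicit Defensive.

Import Order.TTheory GRing.Theory Num.Theory.
Local Open Scope ring_scope.
Local Open Scope quotient_scope.

(* A [k]-algebra, presented as a ring with a morphism from [k] to its center;
   [c%:S * x] is the scalar multiple of [x] by [c].  MathComp's [algType]
   excludes the zero ring, which would force nontriviality proofs for every
   quotient and tensor product below. *)
HB.mixin Record isPzAlgebra (k : comPzRingType) A of GRing.PzRing A := {
  scal : k -> A;
  scal_is_zmod_morphism : zmod_morphism scal;
  scal_is_monoid_morphism : monoid_morphism scal;
  scalC : forall c x, scal c * x = x * scal c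
}.
#[short(type="pzAlgType")]
HB.structure Definition PzAlgebra (k : comPzRingType) :=
  {A of isPzAlgebra k A & GRing.PzRing A}.
Notation "c %:S" := (scal c) (at level 2, left associativity, format "c %:S")
  : ring_scope.
HB.instance Definition _ (k : comPzRingType) (A : pzAlgType k) :=
  GRing.isZmodMorphism.Build k A (@scal k A) scal_is_zmod_morphism.
HB.instance Definition _ (k : comPzRingType) (A : pzAlgType k) :=
  GRing.isMonoidMorphism.Build k A (@scal k A) scal_is_monoid_morphism.

HB.mixin Record isAlgHom (k : comPzRingType) (A B : pzAlgType k) (f : A -> B)
  := { ahom_scal : forall c : k, f c%:S = c%:S }.
HB.structure Definition AlgHom (k : comPzRingType) (A B : pzAlgType k) :=
  {f of @GRing.RMorphism A B f & isAlgHom k A B f}.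
Notation "{ 'alghom' A -> B }" := (AlgHom.type A B)
  (at level 0, A at level 98, B at level 99,
   format "{ 'alghom'  A  ->  B }") : type_scope.

Section BaseRing.
Context {k : comPzRingType}.
Fact id_zmod : zmod_morphism (id : k -> k^o). Proof. by []. Qed.
Fact id_monoid : monoid_morphism (id : k -> k^o). Proof. by []. Qed.
Fact id_central (c : k) (x : k^o) : (c : k^o) * x = x * (c : k^o).
Proof. exact: mulrC. Qed.
HB.instance Definition _ :=
  isPzAlgebra.Build k k^o id_zmod id_monoid id_central.
End BaseRing.

Section Span.
Context {k : comPzRingType} {A : pzAlgType k}.
Implicit Types (S : set A).

Inductive span S : set A :=
| span0 : span S 0
| span_cons c s v : S s -> span S v -> span S (c%:S * s + v).

Lemma spanD S x y : span S x -> span S y -> span S (x + y).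
Proof.
move=> Sx Sy; elim: Sx => [|c s v Ss _ IH]; first by rewrite add0r.
by rewrite -addrA; apply: span_cons.
Qed.

Lemma spanZ S c x : span S x -> span S (c%:S * x).
Proof.
elim=> [|d s v Ss _ IH]; first by rewrite mulr0; apply: span0.
by rewrite mulrDr mulrA -rmorphM; apply: span_cons.
Qed.

Lemma span_in S x : S x -> span S x.
Proof.
move=> Sx; rewrite -[x]mul1r -[1](rmorph1 (@scal k A)) -[_ * _]addr0.
by apply: span_cons => //; apply: span0.
Qed.

Lemma span_le S (P : set A) : P 0 -> (forall x y, P x -> P y -> P (x + y)) ->
  (forall (c : k) x, P x -> P (c%:S * x)) -> (S `<=` P)%classic ->
  (span S `<=` P)%classic.
Proof.
move=> P0 PD PZ SP x; elim=> [//|c s v Ss _ Pv].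
by apply: PD => //; apply/PZ/SP.
Qed.

Lemma spanM S T U : (forall x y, S x -> T y -> U (x * y)) ->
  forall x y, span S x -> span T y -> span U (x * y).
Proof.
move=> STU x y; elim=> [|c s v Ss _ IH] Ty; first by rewrite mul0r; apply: span0.
rewrite mulrDl; apply: spanD; last exact: IH.
rewrite -mulrA; apply: spanZ; elim: Ty => [|d t w Tt _ IH'].
  by rewrite mulr0; apply: span0.
rewrite mulrDr; apply: spanD => //.
by rewrite mulrA -scalC -mulrA; apply/spanZ/span_in/STU.
Qed.

End Span.

Section MonoidAlgebraModule.
Definition monalg (A : zmodType) (M : choiceType) := {fsfun M -> A with 0}.

Context {M : choiceType}.

HB.instance Definition _ (A : zmodType) :=
  Choice.on (monalg A M).

Section Zmod.
Context {A : zmodType}.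
Implicit Types f g : monalg A M.

Definition coef (m : M) (f : monalg A M) : A := f m.
Definition mzero : monalg A M := [fsfun].
Definition mopp f : monalg A M := [fsfun m in finsupp f => - f m].
Definition madd f g : monalg A M :=
  [fsfun m in (finsupp f `|` finsupp g)%fset => f m + g m].

Lemma monalgP f g : (forall m, coef m f = coef m g) <-> f = g.
Proof. by split=> [h|-> //]; apply/fsfunP. Qed.

Fact mzeroE m : coef m mzero = 0. Proof. by rewrite /coef fsfun0E. Qed.
Fact moppE f m : coef m (mopp f) = - coef m f.
Proof.
by rewrite /coef fsfun_fun; case: finsuppP; rewrite ?oppr0.
Qed.
Fact maddE f g m : coef m (madd f g) = coef m f + coef m g.
Proof.
rewrite /coef fsfun_fun in_fsetE.
by case: (finsuppP f); case: (finsuppP g); rewrite ?addr0.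
Qed.
Fact maddA : associative madd.
Proof. by move=> f g h; apply/monalgP => m; rewrite !maddE addrA. Qed.
Fact maddC : commutative madd.
Proof. by move=> f g; apply/monalgP => m; rewrite !maddE addrC. Qed.
Fact madd0 : left_id mzero madd.
Proof. by move=> f; apply/monalgP => m; rewrite maddE mzeroE add0r. Qed.
Fact maddN : left_inverse mzero mopp madd.
Proof. by move=> f; apply/monalgP => m; rewrite maddE moppE mzeroE addNr. Qed.

HB.instance Definition _ :=
  GRing.isZmodule.Build (monalg A M) maddA maddC madd0 maddN.

Lemma coef_is_zmod_morphism m : zmod_morphism (coef m).
Proof. by move=> f g; rewrite [LHS]maddE moppE. Qed.
HB.instance Definition _ m :=
  GRing.isZmodMorphism.Build (monalg A M) A (coef m) (coef_is_zmod_morphism m).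

(* The monomial with coefficient [a] at [m]. *)
Definition mon (m : M) (a : A) : monalg A M := [fsfun x in [fset m]%fset => a].

Lemma coef_mon m a x : coef x (mon m a) = if x == m then a else 0.
Proof. by rewrite /coef fsfun_fun in_fset1. Qed.

Lemma mon_is_zmod_morphism m : zmod_morphism (mon m).
Proof.
move=> a b; apply/monalgP => x; rewrite raddfB /= !coef_mon.
by case: eqP => _; rewrite ?subr0.
Qed.
HB.instance Definition _ m :=
  GRing.isZmodMorphism.Build A (monalg A M) (mon m) (mon_is_zmod_morphism m).

Lemma coefN0 f m : m \notin finsupp f -> coef m f = 0.
Proof. by rewrite memNfinsupp => /eqP. Qed.

(* The additive extension of [F] to [monalg A M]. *)
Definition mext (B : zmodType) (F : M -> A -> B) f : B :=
  \sum_(m <- finsupp f) F m (coef m f).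

Lemma mext_w (B : zmodType) (F : M -> A -> B) (D : {fset M}) f :
  (forall m, F m 0 = 0) -> (finsupp f `<=` D)%fset ->
  mext F f = \sum_(m <- D) F m (coef m f).
Proof.
move=> mext_arg0 fD; rewrite /mext; apply/big_fset_incl => // x _ xf.
by rewrite coefN0.
Qed.

Lemma monalgE f : f = mext mon f.
Proof.
apply/monalgP => m; rewrite /mext raddf_sum /=.
have [mf|mf] := boolP (m \in finsupp f).
  rewrite (big_fsetD1 m) //= coef_mon eqxx big1_fset ?addr0 // => x.
  by rewrite in_fsetD1 coef_mon eq_sym; case: eqP.
rewrite coefN0 // big1_fset // => x xf _; rewrite coef_mon; case: eqP => // e.
by move: mf; rewrite e xf.
Qed.

Lemma monalg_ind (P : monalg A M -> Prop) : P 0 ->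
  (forall f g, P f -> P g -> P (f + g)) -> (forall m a, P (mon m a)) ->
  forall f, P f.
Proof.
move=> P0 PD PU f; rewrite [f]monalgE /mext.
by elim/big_rec: _ => // m g _; apply: PD.
Qed.

Section Ext.
Context {B : zmodType} (F : M -> A -> B).
Hypothesis FB : forall m, zmod_morphism (F m).
Let mext_arg0 m : F m 0 = 0. Proof. by rewrite -(subrr 0) FB subrr. Qed.

Lemma mextB : zmod_morphism (mext F).
Proof.
move=> f g; set D := (finsupp f `|` finsupp g `|` finsupp (f - g))%fset.
rewrite !(@mext_w _ F D) //; last 3 first.
- by rewrite /D fsubsetU // fsubsetUr.
- by rewrite /D fsubsetU // fsubsetUl.
- exact: fsubsetUr.
by rewrite -sumrB; apply: eq_bigr => m _; rewrite raddfB /= FB.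
Qed.

Lemma mext_mon m a : mext F (mon m a) = F m a.
Proof.
rewrite (@mext_w _ _ [fset m]%fset) //; last first.
  by apply/fsubsetP => x; rewrite mem_finsupp in_fset1 -/(coef x _) coef_mon;
     case: ifP => //; rewrite eqxx.
by rewrite big_seq_fset1 coef_mon eqxx.
Qed.
End Ext.

End Zmod.

End MonoidAlgebraModule.
Arguments monalg A M : clear implicits.

Section MonoidAlgebraRing.
Context {A : pzRingType} {M : monoidType}.
Implicit Types f g h : monalg A M.

Definition mmul f g : monalg A M :=
  mext (fun a x => mext (fun b y => mon (a * b)%g (x * y)) g) f.

Let mmul_inB (a : M) (x : A) (b : M) :
  zmod_morphism (fun y : A => mon (a * b)%g (x * y)).
Proof. by move=> y z; rewrite mulrBr raddfB. Qed.

Let mmul_outB g (a : M) :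
  zmod_morphism (fun x : A => mext (fun b y => mon (a * b)%g (x * y)) g).
Proof.
move=> x y; rewrite /mext -sumrB; apply: eq_bigr => b _.
by rewrite mulrBl raddfB.
Qed.

Fact mmulBl f g h : mmul (f - g) h = mmul f h - mmul g h.
Proof. by rewrite /mmul mextB. Qed.
Fact mmulBr f g h : mmul f (g - h) = mmul f g - mmul f h.
Proof.
rewrite /mmul [mext _ f]/mext [X in _ = X - _]/mext.
rewrite [X in _ = _ - X]/mext -sumrB; apply: eq_bigr => a _.
by rewrite mextB //; apply: mmul_inB.
Qed.
Fact mmul0l f : mmul 0 f = 0. Proof. by rewrite -[0 in LHS](subrr 0) mmulBl subrr. Qed.
Fact mmul0r f : mmul f 0 = 0. Proof. by rewrite -[0 in LHS](subrr 0) mmulBr subrr. Qed.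
Fact mmulDl : left_distributive mmul +%R.
Proof.
move=> f g h; rewrite -[g in LHS]opprK mmulBl -[- g]sub0r mmulBl mmul0l sub0r.
by rewrite opprK.
Qed.
Fact mmulDr : right_distributive mmul +%R.
Proof.
move=> f g h; rewrite -[h in LHS]opprK mmulBr -[- h]sub0r mmulBr mmul0r sub0r.
by rewrite opprK.
Qed.

Fact mmul_mon a b x y : mmul (mon a x) (mon b y) = mon (a * b)%g (x * y).
Proof. by rewrite /mmul mext_mon; [apply/mext_mon/mmul_inB | exact: mmul_outB]. Qed.

Fact mmulA : associative mmul.
Proof.
move=> f g h; elim/(@monalg_ind M A): f => [|f f' Hf Hf'|a x].
- by rewrite !mmul0l.
- by rewrite !mmulDl Hf Hf'.
elim/(@monalg_ind M A): g => [|g g' Hg Hg'|b y].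
- by rewrite mmul0l !mmul0r mmul0l.
- by rewrite !(mmulDl, mmulDr) Hg Hg'.
elim/(@monalg_ind M A): h => [|h h' Hh Hh'|c z].
- by rewrite !mmul0r.
- by rewrite !mmulDr Hh Hh'.
by rewrite !mmul_mon mulrA mulgA.
Qed.
Definition mone : monalg A M := mon 1%g 1.
Fact mmul1l : left_id mone mmul.
Proof.
move=> f; elim/(@monalg_ind M A): f => [|f g Hf Hg|a x].
- exact: mmul0r.
- by rewrite mmulDr Hf Hg.
by rewrite mmul_mon mul1r mul1g.
Qed.
Fact mmul1r : right_id mone mmul.
Proof.
move=> f; elim/(@monalg_ind M A): f => [|f g Hf Hg|a x].
- exact: mmul0l.
- by rewrite mmulDl Hf Hg.
by rewrite mmul_mon mulr1 mulg1.
Qed.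
HB.instance Definition _ := GRing.Zmodule_isPzRing.Build (monalg A M)
  mmulA mmul1l mmul1r mmulDl mmulDr.

Lemma monM a b (x y : A) : mon a x * mon b y = mon (a * b)%g (x * y).
Proof. exact: mmul_mon. Qed.
Lemma mon1 : mon 1%g 1 = 1 :> monalg A M. Proof. by []. Qed.

End MonoidAlgebraRing.

Section MonoidAlgebra.
Context {k : comPzRingType} {A : pzAlgType k} {M : monoidType}.

Definition mscal (c : k) : monalg A M := mon 1%g c%:S.
Fact mscal_zmod : zmod_morphism mscal.
Proof. by move=> c d; rewrite /mscal !raddfB. Qed.
Fact mscal_monoid : monoid_morphism mscal.
Proof.
by split=> [|c d]; rewrite /mscal ?rmorph1 ?mon1 // monM mulg1 rmorphM.
Qed.
Fact mscalC c (f : monalg A M) : mscal c * f = f * mscal c.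
Proof.
elim/(@monalg_ind M A): f => [|f g Hf Hg|a x]; first by rewrite mulr0 mul0r.
  by rewrite mulrDr mulrDl Hf Hg.
by rewrite !monM mulg1 mul1g scalC.
Qed.
HB.instance Definition _ :=
  isPzAlgebra.Build k (monalg A M) mscal_zmod mscal_monoid mscalC.

Lemma scal_mon c a (x : A) : c%:S * mon a x = mon a (c%:S * x) :> monalg A M.
Proof. by rewrite monM mul1g. Qed.
End MonoidAlgebra.

(* The map of monoid algebras induced by [phi]. *)
Definition monalg_map (A : zmodType) (M M' : choiceType) (phi : M -> M')
    (f : monalg A M) : monalg A M' :=
  mext (fun m a => mon (phi m) a) f.

Section MonoidAlgebraMap.
Context {A : pzRingType} {M M' : monoidType} (phi : M -> M').
Hypothesis phi1 : phi 1%g = 1%g.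
Hypothesis phiM : {morph phi : x y / (x * y)%g}.
Let monalg_map_argB m : zmod_morphism (fun a : A => mon (phi m) a).
Proof. by move=> a b; rewrite raddfB. Qed.

Lemma monalg_mapB : zmod_morphism (monalg_map phi : monalg A M -> _).
Proof. exact: mextB. Qed.

Lemma monalg_map_mon m (a : A) : monalg_map phi (mon m a) = mon (phi m) a.
Proof. exact: mext_mon. Qed.

Lemma monalg_mapM (f g : monalg A M) :
  monalg_map phi (f * g) = monalg_map phi f * monalg_map phi g.
Proof.
have B0 : monalg_map phi (0 : monalg A M) = 0.
  by rewrite -[0 in LHS](subrr 0) monalg_mapB subrr.
have BD (x y : monalg A M) :
    monalg_map phi (x + y) = monalg_map phi x + monalg_map phi y.
  by rewrite -[y in LHS]opprK monalg_mapB -[- y]sub0r monalg_mapB B0 sub0r opprK.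
elim/(@monalg_ind M A): f => [|f f' Hf Hf'|a x].
- by rewrite mul0r B0 mul0r.
- by rewrite mulrDl !BD Hf Hf' mulrDl.
elim/(@monalg_ind M A): g => [|g g' Hg Hg'|b y].
- by rewrite mulr0 B0 mulr0.
- by rewrite mulrDr !BD Hg Hg' mulrDr.
by rewrite monM !monalg_map_mon monM phiM.
Qed.
End MonoidAlgebraMap.

Section Ideals.
Context {k : comPzRingType}.

(* Two-sided ideals; stability under scalars follows from [idealMl]. *)
Record ideal (A : pzAlgType k) := Ideal {
  ideal_set :> A -> Prop;
  ideal0 : ideal_set 0;
  idealD : forall x y, ideal_set x -> ideal_set y -> ideal_set (x + y);
  idealMl : forall a x, ideal_set x -> ideal_set (a * x);
  idealMr : forall a x, ideal_set x -> ideal_set (x * a) }.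

Section Generated.
Context {A : pzAlgType k} (S : set A).

Inductive gen_ideal_set : set A :=
| gen_ideal_in x : S x -> gen_ideal_set x
| gen_ideal0 : gen_ideal_set 0
| gen_idealD x y : gen_ideal_set x -> gen_ideal_set y -> gen_ideal_set (x + y)
| gen_idealMl a x : gen_ideal_set x -> gen_ideal_set (a * x)
| gen_idealMr a x : gen_ideal_set x -> gen_ideal_set (x * a).

Definition gen_ideal : ideal A :=
  Ideal gen_ideal0 gen_idealD gen_idealMl gen_idealMr.
End Generated.

Context {A : pzAlgType k} (I : ideal A).
Implicit Types x y : A.

Lemma idealN x : I x -> I (- x).
Proof. by rewrite -mulN1r; apply: idealMl. Qed.
Lemma idealB x y : I x -> I y -> I (x - y).
Proof. by move=> Ix Iy; apply/idealD/idealN. Qed.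

Definition ideal_eq : rel A := fun x y => `[< I (x - y) >].
Fact ideal_eqP : equiv_class_of ideal_eq.
Proof.
split=> [x|x y|y x z]; rewrite /ideal_eq.
- by rewrite subrr; apply/asboolP/ideal0.
- by apply/asbool_equiv_eq; split=> /idealN; rewrite opprB.
move=> /asboolP xy /asboolP yz; apply/asboolP.
by rewrite -[x - z](subrKA y); apply: idealD.
Qed.
Canonical ideal_equiv := EquivRelPack ideal_eqP.
Canonical ideal_encModRel := defaultEncModRel ideal_eq.

Definition quotalg := {eq_quot ideal_eq}.
HB.instance Definition _ : EqQuotient A ideal_eq quotalg := EqQuotient.on quotalg.
HB.instance Definition _ := Choice.on quotalg.

Definition qpi (x : A) : quotalg := \pi_quotalg x.

Lemma qpi_eq x y : qpi x = qpi y <-> I (x - y).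
Proof.
split=> [/eqP|h]; first by rewrite eqmodE => /asboolP.
by apply/eqP; rewrite eqmodE; apply/asboolP.
Qed.
Lemma qpiK (u : quotalg) : qpi (repr u) = u. Proof. exact: reprK. Qed.
Lemma qpi_repr x : I (repr (qpi x) - x).
Proof. by apply/qpi_eq; rewrite qpiK. Qed.
Lemma qpi_ind (P : quotalg -> Prop) : (forall x, P (qpi x)) -> forall u, P u.
Proof. by move=> h u; rewrite -[u]qpiK. Qed.

Definition qadd (u v : quotalg) : quotalg := qpi (repr u + repr v).
Definition qopp (u : quotalg) : quotalg := qpi (- repr u).
Definition qmul (u v : quotalg) : quotalg := qpi (repr u * repr v).

Fact qaddE x y : qadd (qpi x) (qpi y) = qpi (x + y).
Proof. by apply/qpi_eq; rewrite opprD addrACA; apply: idealD; apply: qpi_repr. Qed.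
Fact qoppE x : qopp (qpi x) = qpi (- x).
Proof. by apply/qpi_eq; rewrite -opprD; apply/idealN/qpi_repr. Qed.
Fact qmulE x y : qmul (qpi x) (qpi y) = qpi (x * y).
Proof.
apply/qpi_eq; rewrite -(subrKA (x * repr (qpi y))) -mulrBl -mulrBr.
by apply: idealD; [apply: idealMr | apply: idealMl]; apply: qpi_repr.
Qed.

Fact qaddA : associative qadd.
Proof.
elim/qpi_ind=> x; elim/qpi_ind=> y; elim/qpi_ind=> z.
by rewrite !qaddE addrA.
Qed.
Fact qaddC : commutative qadd.
Proof. by elim/qpi_ind=> x; elim/qpi_ind=> y; rewrite !qaddE addrC. Qed.
Fact qadd0 : left_id (qpi 0) qadd.
Proof. by elim/qpi_ind=> x; rewrite qaddE add0r. Qed.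
Fact qaddN : left_inverse (qpi 0) qopp qadd.
Proof. by elim/qpi_ind=> x; rewrite qoppE qaddE addNr. Qed.
HB.instance Definition _ := GRing.isZmodule.Build quotalg qaddA qaddC qadd0 qaddN.

Fact qmulA : associative qmul.
Proof.
elim/qpi_ind=> x; elim/qpi_ind=> y; elim/qpi_ind=> z.
by rewrite !qmulE mulrA.
Qed.
Fact qmul1l : left_id (qpi 1) qmul.
Proof. by elim/qpi_ind=> x; rewrite qmulE mul1r. Qed.
Fact qmul1r : right_id (qpi 1) qmul.
Proof. by elim/qpi_ind=> x; rewrite qmulE mulr1. Qed.
Fact qmulDl : left_distributive qmul +%R.
Proof.
elim/qpi_ind=> x; elim/qpi_ind=> y; elim/qpi_ind=> z.
by rewrite /GRing.add /= !(qaddE, qmulE) mulrDl.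
Qed.
Fact qmulDr : right_distributive qmul +%R.
Proof.
elim/qpi_ind=> x; elim/qpi_ind=> y; elim/qpi_ind=> z.
by rewrite /GRing.add /= !(qaddE, qmulE) mulrDr.
Qed.
HB.instance Definition _ := GRing.Zmodule_isPzRing.Build quotalg
  qmulA qmul1l qmul1r qmulDl qmulDr.

Fact qpi_zmod : zmod_morphism qpi.
Proof. by move=> x y; rewrite -qaddE -qoppE. Qed.
HB.instance Definition _ := GRing.isZmodMorphism.Build A quotalg qpi qpi_zmod.
Fact qpi_monoid : monoid_morphism qpi.
Proof. by split=> // x y; rewrite -qmulE. Qed.
HB.instance Definition _ := GRing.isMonoidMorphism.Build A quotalg qpi qpi_monoid.

Definition qscal (c : k) : quotalg := qpi c%:S.
Fact qscal_zmod : zmod_morphism qscal.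
Proof. by move=> c d; rewrite /qscal !raddfB. Qed.
Fact qscal_monoid : monoid_morphism qscal.
Proof. by split=> [|c d]; rewrite /qscal ?rmorph1 // !rmorphM. Qed.
Fact qscalC c u : qscal c * u = u * qscal c.
Proof. by elim/qpi_ind: u => x; rewrite /qscal -!rmorphM scalC. Qed.
HB.instance Definition _ :=
  isPzAlgebra.Build k quotalg qscal_zmod qscal_monoid qscalC.
HB.instance Definition _ := isAlgHom.Build k A quotalg qpi (fun c => erefl).

Lemma qpi_eq0 x : qpi x = 0 <-> I x.
Proof. by rewrite -(raddf0 qpi) qpi_eq subr0. Qed.

End Ideals.

Section Subalgebras.
Context {k : comPzRingType}.

Record subalgebra (A : pzAlgType k) := Subalgebra {
  subalg_set :> A -> Prop;
  subalgS : forall c : k, subalg_set c%:S;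
  subalgB : forall x y, subalg_set x -> subalg_set y -> subalg_set (x - y);
  subalgM : forall x y, subalg_set x -> subalg_set y -> subalg_set (x * y) }.

Context {A : pzAlgType k} (S : subalgebra A).

Lemma subalg0 : S 0. Proof. by rewrite -(raddf0 (@scal k A)); apply: subalgS. Qed.
Lemma subalg1 : S 1. Proof. by rewrite -(rmorph1 (@scal k A)); apply: subalgS. Qed.
Lemma subalgN x : S x -> S (- x).
Proof. by move=> Sx; rewrite -sub0r; apply: subalgB => //; apply: subalg0. Qed.
Lemma subalgD x y : S x -> S y -> S (x + y).
Proof. by move=> Sx Sy; rewrite -[y]opprK; apply/subalgB/subalgN. Qed.
Lemma subalg_sum (T : Type) (r : seq T) (P : pred T) (F : T -> A) :
  (forall i, P i -> S (F i)) -> S (\sum_(i <- r | P i) F i).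
Proof. by move=> SF; elim/big_ind: _ => //; [exact: subalg0 | exact: subalgD]. Qed.

Definition subalg_pred : {pred A} := fun x => `[< S x >].
Fact subalg_closed : subring_closed subalg_pred.
Proof.
split=> [|x y|x y]; rewrite !unfold_in.
- by apply/asboolP; apply: subalg1.
- by move=> /asboolP Sx /asboolP Sy; apply/asboolP; apply: subalgB.
- by move=> /asboolP Sx /asboolP Sy; apply/asboolP; apply: subalgM.
Qed.

Record subalg := SubalgElt { saval : A; _ : subalg_pred saval }.
HB.instance Definition _ := [isSub for saval].
HB.instance Definition _ := [Choice of subalg by <:].
HB.instance Definition _ :=
  GRing.SubChoice_isSubPzRing.Build A subalg_pred subalg subalg_closed.

Definition inS (x : A) (Sx : S x) : subalg := SubalgElt (introT (asboolP _) Sx).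
Lemma savalP (u : subalg) : S (saval u).
Proof. by case: u => x /= /asboolP. Qed.

Definition sscal (c : k) : subalg := inS (subalgS S c).
Fact sscal_zmod : zmod_morphism sscal.
Proof. by move=> c d; apply: val_inj; rewrite /= !raddfB. Qed.
Fact sscal_monoid : monoid_morphism sscal.
Proof. by split=> [|c d]; apply: val_inj; rewrite /= ?rmorph1 ?rmorphM. Qed.
Fact sscalC c (u : subalg) : sscal c * u = u * sscal c.
Proof. by apply: val_inj; rewrite !rmorphM /= scalC. Qed.
HB.instance Definition _ :=
  isPzAlgebra.Build k subalg sscal_zmod sscal_monoid sscalC.

Fact saval_zmod : zmod_morphism saval. Proof. by move=> u v; rewrite -[saval]/val raddfB. Qed.
Fact saval_monoid : monoid_morphism saval. 
Proof. by split. Qed.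
HB.instance Definition _ := GRing.isZmodMorphism.Build subalg A saval saval_zmod.
HB.instance Definition _ := GRing.isMonoidMorphism.Build subalg A saval saval_monoid.
HB.instance Definition _ := isAlgHom.Build k subalg A saval (fun c => erefl).

End Subalgebras.
Arguments saval {k A S} u : rename.

(* Decreasing algebra filtrations indexed by the integers. *)
Record filtration (k : comPzRingType) (A : pzAlgType k) := Filtration {
  fil :> int -> A -> Prop;
  fil0 : forall m, fil m 0;
  filD : forall m x y, fil m x -> fil m y -> fil m (x + y);
  filS : forall m (c : k) x, fil m x -> fil m (c%:S * x);
  fil_decr : forall m x, fil (m + 1) x -> fil m x;
  fil_one : fil 0 1;
  filM : forall m n x y, fil m x -> fil n y -> fil (m + n) (x * y) }.

(* The integers as a multiplicative monoid: monomials of the Laurent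
   polynomial ring [A[t, t^-1] = monalg A zdeg]. *)
Definition zdeg := int.
HB.instance Definition _ := Choice.on zdeg.
HB.instance Definition _ := isMonoid.Build zdeg
  (@addrA int) (@add0r int) (@addr0 int).

Section AssociatedGraded.
Context {k : comPzRingType} {A : pzAlgType k} (F : filtration A).
Implicit Types (f g : monalg A zdeg) (m n : int).

Lemma filN m x : F m x -> F m (- x).
Proof.
by move=> Fx; rewrite -mulN1r -(rmorphN1 (@scal k A)); apply: filS.
Qed.
Lemma filB m x y : F m x -> F m y -> F m (x - y).
Proof. by move=> Fx Fy; apply/filD/filN. Qed.
Lemma filMl m x y : F 0 x -> F m y -> F m (x * y).
Proof. by move=> Fx Fy; rewrite -[m]add0r; apply: filM. Qed.

Definition rees_set f := forall m, F m (coef m f).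

Fact reesB f g : rees_set f -> rees_set g -> rees_set (f - g).
Proof. by move=> Ff Fg m; rewrite raddfB; apply: filB. Qed.
Fact rees_mon m x : F m x -> rees_set (mon m x).
Proof. by move=> Fx n; rewrite coef_mon; case: eqP => [->|_] //; apply: fil0. Qed.
Fact rees_sum (T : Type) (r : seq T) (G : T -> monalg A zdeg) :
  (forall i, rees_set (G i)) -> rees_set (\sum_(i <- r) G i).
Proof. by move=> RG m; rewrite raddf_sum; elim/big_ind: _ => [|x y|i _];
  [apply: fil0 | apply: filD | apply: RG]. Qed.
Fact mul_monE f g : f * g = \sum_(a <- finsupp f) \sum_(b <- finsupp g)
  mon (a * b)%g (coef a f * coef b g).
Proof. by []. Qed.
Fact reesM f g : rees_set f -> rees_set g -> rees_set (f * g).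
Proof.
move=> Ff Fg; rewrite mul_monE; apply: rees_sum => a; apply: rees_sum => b.
by apply/rees_mon/filM.
Qed.
Fact reesS (c : k) : rees_set c%:S.
Proof. by apply: rees_mon; rewrite -[c%:S]mulr1; apply/filS/fil_one. Qed.

(* [\bigoplus_m F^m t^m], as a subalgebra of [A[t, t^-1]]. *)
Definition rees := Subalgebra reesS reesB reesM.

Definition gr_ideal_set (u : subalg rees) : Prop :=
  forall m, F (m + 1) (coef m (saval u)).
Fact gr_ideal0 : gr_ideal_set 0.
Proof. by move=> m; rewrite !raddf0; apply: fil0. Qed.
Fact gr_idealD u v : gr_ideal_set u -> gr_ideal_set v -> gr_ideal_set (u + v).
Proof. by move=> Ju Jv m; rewrite !raddfD; apply: filD. Qed.
Fact shift_sum (T : Type) (r : seq T) (G : T -> monalg A zdeg) :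
  (forall i m, F (m + 1) (coef m (G i))) ->
  forall m, F (m + 1) (coef m (\sum_(i <- r) G i)).
Proof. by move=> RG m; rewrite raddf_sum; elim/big_ind: _ => [|x y|i _];
  [apply: fil0 | apply: filD | apply: RG]. Qed.
Fact shift_mon n x : F (n + 1) x -> forall m, F (m + 1) (coef m (mon n x)).
Proof. by move=> Fx m; rewrite coef_mon; case: eqP => [->|_] //; apply: fil0. Qed.
Fact gr_idealMl u v : gr_ideal_set v -> gr_ideal_set (u * v).
Proof.
move=> Jv; rewrite /gr_ideal_set rmorphM /= mul_monE.
apply: shift_sum => a; apply: shift_sum => b; apply: shift_mon.
by rewrite -[(a * b)%g + 1]addrA; apply: filM => //; apply: (savalP u).
Qed.
Fact gr_idealMr u v : gr_ideal_set v -> gr_ideal_set (v * u).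
Proof.
move=> Jv; rewrite /gr_ideal_set rmorphM /= mul_monE.
apply: shift_sum => a; apply: shift_sum => b; apply: shift_mon.
by rewrite -[(a * b)%g + 1]addrAC; apply: filM => //; apply: (savalP u).
Qed.
Definition gr_ideal := Ideal gr_ideal0 gr_idealD gr_idealMl gr_idealMr.

(* [\bigoplus_m F^m / F^(m+1)], as the quotient of
   [\bigoplus_m F^m t^m] by [\bigoplus_m F^(m+1) t^m]. *)
Definition gr := quotalg gr_ideal.
HB.instance Definition _ := PzAlgebra.on gr.

(* The class [[x]_m]; it is the junk value 0 unless [F m x]. *)
Definition cls (m : int) (x : A) : gr :=
  qpi gr_ideal (insubd (0 : subalg rees) (mon (m : zdeg) x)).

Definition gr_deg (m : int) : set gr :=
  [set y | exists2 x, F m x & y = cls m x]%classic.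

(* The additive map [gr -> B] with [cls m x |-> H m x], see [gr_ext_cls];
   it is computed on a representative [\sum_m x_m t^m]. *)
Definition gr_ext (B : zmodType) (H : int -> A -> B) (y : gr) : B :=
  mext (H : zdeg -> A -> B) (saval (repr y)).

Lemma clsE m x (Fx : F m x) : cls m x = qpi gr_ideal (inS (rees_mon Fx : rees _)).
Proof.
congr (qpi _ _); apply: val_inj; rewrite /insubd insubT //=.
exact/asboolP/rees_mon.
Qed.

Section Ext.
Context {B : zmodType} (H : int -> A -> B).
Hypothesis Hsub : forall m x y, F m x -> F m y -> H m (x - y) = H m x - H m y.
Hypothesis H1 : forall m x, F (m + 1) x -> H m x = 0.

Let gr_ext_arg0 m : H m 0 = 0. Proof. exact/H1/fil0. Qed.

Lemma gr_ext_qpi (u : subalg rees) :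
  gr_ext H (qpi gr_ideal u) = mext (H : zdeg -> A -> B) (saval u).
Proof.
rewrite /gr_ext; have := qpi_repr gr_ideal u; set v := repr _ => Jvu.
apply/eqP; rewrite -subr_eq0; apply/eqP.
rewrite !(@mext_w _ _ _ _ (finsupp (saval v) `|` finsupp (saval u))%fset) //;
  [|exact: fsubsetUr|exact: fsubsetUl].
rewrite -sumrB big1 // => m _; rewrite -Hsub; [|exact: (savalP v m)|exact: (savalP u m)].
by rewrite H1 //; have := Jvu m; rewrite !raddfB.
Qed.

Lemma gr_ext_cls m x : F m x -> gr_ext H (cls m x) = H m x.
Proof.
move=> Fx; rewrite (clsE Fx) gr_ext_qpi /=.
rewrite (@mext_w _ _ _ _ [fset (m : zdeg)]%fset) //; last first.
  apply/fsubsetP => y; rewrite mem_finsupp in_fset1 -/(coef y _) coef_mon.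
  by case: ifP => //; rewrite eqxx.
by rewrite big_seq_fset1 coef_mon eqxx.
Qed.

Lemma gr_extB : zmod_morphism (gr_ext H).
Proof.
elim/(@qpi_ind k _ gr_ideal) => u; elim/(@qpi_ind k _ gr_ideal) => v.
rewrite -(raddfB (qpi gr_ideal)) !gr_ext_qpi raddfB.
set D := (finsupp (saval u) `|` finsupp (saval v) `|` finsupp (saval u - saval v))%fset.
rewrite !(@mext_w _ _ _ _ D) //; last 3 first.
- by rewrite /D fsubsetU // fsubsetUr.
- by rewrite /D fsubsetU // fsubsetUl.
- exact: fsubsetUr.
by rewrite -sumrB; apply: eq_bigr => m _; rewrite raddfB /= Hsub //;
  [exact: (savalP u m)|exact: (savalP v m)].
Qed.
End Ext.

Lemma clsB m x y : F m x -> F m y -> cls m (x - y) = cls m x - cls m y.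
Proof.
move=> Fx Fy; rewrite !clsE //; [exact: filB|] => Fxy.
by rewrite -raddfB; congr (qpi _ _); apply: val_inj; rewrite /= raddfB.
Qed.
Lemma cls_eq0 m x : F m x -> cls m x = 0 <-> F (m + 1) x.
Proof.
move=> Fx; rewrite clsE qpi_eq0; split=> [/(_ m)|Fx1 n] /=; rewrite coef_mon.
  by rewrite eqxx.
by case: eqP => [->|_] //; apply: fil0.
Qed.
Lemma clsM m n x y : F m x -> F n y -> cls m x * cls n y = cls (m + n) (x * y).
Proof.
move=> Fx Fy; rewrite !clsE //; [exact: filM|] => Fxy.
by rewrite -rmorphM; congr (qpi _ _); apply: val_inj; rewrite /= monM.
Qed.
Lemma cls_scal m (c : k) x : F m x -> c%:S * cls m x = cls m (c%:S * x).
Proof.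
move=> Fx; rewrite !clsE //; [exact: filS|] => Fcx.
rewrite -[LHS](rmorphM (qpi gr_ideal) c%:S); congr (qpi _ _).
by apply: val_inj; rewrite /= scal_mon.
Qed.

End AssociatedGraded.

Definition filtered_map (k : comPzRingType) (A B : pzAlgType k)
    (F : filtration A) (G : filtration B) (f : A -> B) : Prop :=
  forall m x, F m x -> G m (f x).

(* The map [[x]_m |-> [f x]_m] induced by a filtered map. *)
Definition gr_map (k : comPzRingType) (A B : pzAlgType k)
    (F : filtration A) (G : filtration B) (f : A -> B) : gr F -> gr G :=
  gr_ext (fun m x => cls G m (f x)).

Lemma gr_map_cls (k : comPzRingType) (A B : pzAlgType k)
    (F : filtration A) (G : filtration B) (f : {alghom A -> B}) m x :
  filtered_map F G f -> F m x -> gr_map G f (cls F m x) = cls G m (f x).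
Proof.
move=> fP Fx; apply: (gr_ext_cls _ _ Fx) => n y => [z Fy Fz|Fy].
  by rewrite raddfB clsB //; apply: fP.
by apply/cls_eq0; [apply/fP/fil_decr | apply: fP].
Qed.

Section TensorProduct.
Context {k : comPzRingType}.

Definition tpair (A B : pzAlgType k) := (A * B)%type.
Section Tpair.
Context {A B : pzAlgType k}.
HB.instance Definition _ := Choice.on (tpair A B).
Definition tpair_mul (p q : tpair A B) : tpair A B := (p.1 * q.1, p.2 * q.2).
Definition tpair_one : tpair A B := (1, 1).
Fact tpair_mulA : associative tpair_mul.
Proof. by move=> p q r; rewrite /tpair_mul !mulrA. Qed.
Fact tpair_mul1 : left_id tpair_one tpair_mul.
Proof. by case=> a b; rewrite /tpair_mul !mul1r. Qed.
Fact tpair_1mul : right_id tpair_one tpair_mul.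
Proof. by case=> a b; rewrite /tpair_mul !mulr1. Qed.
HB.instance Definition _ := isMonoid.Build (tpair A B)
  tpair_mulA tpair_mul1 tpair_1mul.
End Tpair.

Definition tgen (A B : pzAlgType k) (a : A) (b : B)
  : monalg k^o (tpair A B) := mon ((a, b) : tpair A B) (1 : k^o).

Inductive tens_rel (A B : pzAlgType k) : set (monalg k^o (tpair A B)) :=
| tens_relDl a a' b : tens_rel (tgen (a + a') b - (tgen a b + tgen a' b))
| tens_relDr a b b' : tens_rel (tgen a (b + b') - (tgen a b + tgen a b'))
| tens_relSl (c : k) a b : tens_rel (tgen (c%:S * a) b - c%:S * tgen a b)
| tens_relSr (c : k) a b : tens_rel (tgen a (c%:S * b) - c%:S * tgen a b).

(* [A \otimes_k B]: the free module on [A * B] modulo bilinearity.  With the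
   product [(a, b) (a', b') = (a a', b b')], the submodule spanned by the
   bilinearity relations is already the two-sided ideal they generate. *)
Definition tens_ideal (A B : pzAlgType k) := gen_ideal (@tens_rel A B).
Definition tens (A B : pzAlgType k) := quotalg (tens_ideal A B).
HB.instance Definition _ (A B : pzAlgType k) := PzAlgebra.on (tens A B).

Definition tpure (A B : pzAlgType k) (a : A) (b : B) : tens A B :=
  qpi (tens_ideal A B) (tgen a b).

(* The linear map [tens A B -> C] with [tpure a b |-> beta a b], for a bilinear
   map [beta], see [tens_ext_pure]. *)
Definition tens_ext (A B C : pzAlgType k) (beta : A -> B -> C) (t : tens A B)
  : C := mext (fun (p : tpair A B) (c : k^o) => (c : k)%:S * beta p.1 p.2) (repr t).

Definition tens_map (A B A' B' : pzAlgType k) (f : A -> A') (g : B -> B')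
  : tens A B -> tens A' B' := tens_ext (fun a b => tpure (f a) (g b)).

End TensorProduct.
Notation "A \otimes B" := (tens A B)
  (at level 40, left associativity) : type_scope.
Notation "a \otimes b" := (tpure a b)
  (at level 40, left associativity) : ring_scope.

Section TensorTheory.
Context {k : comPzRingType} {A B : pzAlgType k}.
Implicit Types (a : A) (b : B) (c : k).

Lemma tpureDl a a' b : (a + a') \otimes b = a \otimes b + a' \otimes b.
Proof.
by rewrite /tpure -raddfD; apply/qpi_eq/gen_ideal_in/tens_relDl.
Qed.
Lemma tpureDr a b b' : a \otimes (b + b') = a \otimes b + a \otimes b'.
Proof.
by rewrite /tpure -raddfD; apply/qpi_eq/gen_ideal_in/tens_relDr.
Qed.
Lemma tpureSl c a b : (c%:S * a) \otimes b = c%:S * (a \otimes b).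
Proof.
rewrite /tpure -[RHS](rmorphM (qpi (tens_ideal A B)) c%:S).
exact/qpi_eq/gen_ideal_in/tens_relSl.
Qed.
Lemma tpureSr c a b : a \otimes (c%:S * b) = c%:S * (a \otimes b).
Proof.
rewrite /tpure -[RHS](rmorphM (qpi (tens_ideal A B)) c%:S).
exact/qpi_eq/gen_ideal_in/tens_relSr.
Qed.
Lemma tpureM a a' b b' :
  (a \otimes b) * (a' \otimes b') = (a * a') \otimes (b * b').
Proof. by rewrite /tpure -rmorphM /tgen monM mulr1. Qed.
Lemma tpure1 : (1 : A) \otimes (1 : B) = 1.
Proof. by []. Qed.

Section Ext.
Context {C : pzAlgType k} (beta : A -> B -> C).
Hypothesis betaDl : forall a a' b, beta (a + a') b = beta a b + beta a' b.
Hypothesis betaDr : forall a b b', beta a (b + b') = beta a b + beta a b'.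
Hypothesis betaSl : forall c a b, beta (c%:S * a) b = c%:S * beta a b.
Hypothesis betaSr : forall c a b, beta a (c%:S * b) = c%:S * beta a b.

Let ev : monalg k^o (tpair A B) -> C :=
  mext (fun (p : tpair A B) (c : k^o) => (c : k)%:S * beta p.1 p.2).
Let evB : zmod_morphism ev.
Proof. by apply: mextB => p c d; rewrite raddfB mulrBl. Qed.
HB.instance Definition _ := GRing.isZmodMorphism.Build _ C ev evB.
Let ev_mon a b (c : k^o) : ev (mon ((a, b) : tpair A B) c) = (c : k)%:S * beta a b.
Proof. by rewrite /ev mext_mon //= => p d e; rewrite raddfB mulrBl. Qed.

Let ev_rel x y z : tens_rel x -> ev (y * x * z) = 0.
Proof.
move=> rx; elim/(@monalg_ind (tpair A B) k^o): y => [|y y' IH IH'|[a0 b0] u].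
- by rewrite !mul0r raddf0.
- by rewrite !mulrDl raddfD /= IH IH' addr0.
elim/(@monalg_ind (tpair A B) k^o): z => [|z z' IH IH'|[a1 b1] v].
- by rewrite !mulr0 raddf0.
- by rewrite !mulrDr raddfD /= IH IH' addr0.
case: rx => [a a' b|a b b'|c a b|c a b];
  rewrite /tgen ?scal_mon !(mulrDr, mulrDl, mulrN, mulNr, monM) /=;
  rewrite !(raddfD, raddfN) /= !ev_mon /= !mulr1;
  rewrite ?(mulrDl, mulrDr, betaDl, betaDr) ?mulr1 ?rmorph1 ?mul1r ?mulr1.
- by rewrite -opprD subrr.
- by rewrite -opprD subrr.
- have -> : a0 * (c%:S * a) * a1 = c%:S * (a0 * a * a1).
    by rewrite !mulrA scalC.
  by rewrite betaSl mulrA -rmorphM mulrAC subrr.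
- have -> : b0 * (c%:S * b) * b1 = c%:S * (b0 * b * b1).
    by rewrite !mulrA scalC.
  by rewrite betaSr mulrA -rmorphM mulrAC subrr.
Qed.

Let ev_ideal x : tens_ideal A B x -> ev x = 0.
Proof.
move=> Ix; suff: forall y z, ev (y * x * z) = 0.
  by move=> /(_ 1 1); rewrite mul1r mulr1.
elim: Ix => [{}x rx||x1 x2 _ IH1 _ IH2|a {}x _ IH|a {}x _ IH] y z.
- exact: ev_rel.
- by rewrite mulr0 mul0r raddf0.
- by rewrite mulrDr mulrDl raddfD /= IH1 IH2 addr0.
- by rewrite mulrA IH.
- by rewrite mulrA -[_ * a * z]mulrA IH.
Qed.

Lemma tens_ext_qpi x : tens_ext beta (qpi (tens_ideal A B) x) = ev x.
Proof.
have /ev_ideal/eqP := qpi_repr (tens_ideal A B) x.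
by rewrite raddfB subr_eq0 => /eqP.
Qed.

Lemma tens_ext_pure a b : tens_ext beta (a \otimes b) = beta a b.
Proof. by rewrite tens_ext_qpi ev_mon rmorph1 mul1r. Qed.

Lemma tens_extB : zmod_morphism (tens_ext beta).
Proof.
elim/(@qpi_ind k _ (tens_ideal A B)) => x.
elim/(@qpi_ind k _ (tens_ideal A B)) => y.
by rewrite -raddfB !tens_ext_qpi raddfB.
Qed.

End Ext.
End TensorTheory.

Lemma tens_map_pure (k : comPzRingType) (A B A' B' : pzAlgType k)
    (f : {alghom A -> A'}) (g : {alghom B -> B'}) a b :
  tens_map f g (a \otimes b) = f a \otimes g b.
Proof.
rewrite /tens_map tens_ext_pure // => [x y z|x y z|c x y|c x y].
- by rewrite raddfD tpureDl.
- by rewrite raddfD tpureDr.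
- by rewrite rmorphM /= ahom_scal tpureSl.
- by rewrite rmorphM /= ahom_scal tpureSr.
Qed.

Section TensorFiltration.
Context {k : comPzRingType} {A B : pzAlgType k}.
Context (F : filtration A) (G : filtration B).

(* [\sum_(i + j = m) F^i \otimes G^j] *)
Definition tens_fil_set (m : int) : set (A \otimes B) :=
  span [set t | exists i j a b,
    [/\ i + j = m, F i a, G j b & t = a \otimes b]]%classic.

Fact tens_fil_decr m x : tens_fil_set (m + 1) x -> tens_fil_set m x.
Proof.
apply: (span_le (P := tens_fil_set m)).
- exact: span0.
- by move=> ? ?; apply: spanD.
- by move=> ? ?; apply: spanZ.
move=> t [i [j [a [b [ijm Fa Gb ->]]]]]; apply: span_in.
exists (i - 1), j, a, b; split=> //; first by rewrite addrAC ijm addrK.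
by apply: fil_decr; rewrite subrK.
Qed.
Fact tens_fil_one : tens_fil_set 0 1.
Proof.
by apply: span_in; exists 0, 0, 1, 1; split; rewrite ?addr0 //; apply: fil_one.
Qed.
Fact tens_filM m n x y : tens_fil_set m x -> tens_fil_set n y ->
  tens_fil_set (m + n) (x * y).
Proof.
apply: spanM => _ _ [i [j [a [b [<- Fa Gb ->]]]]] [i' [j' [a' [b' [<- Fa' Gb' ->]]]]].
exists (i + i'), (j + j'), (a * a'), (b * b'); split; last by rewrite tpureM.
- by rewrite addrACA.
- exact: filM.
- exact: filM.
Qed.

Definition tens_fil : filtration (A \otimes B)%type :=
  Filtration (fun m => span0 _) (fun m => @spanD _ _ _)
    (fun m => @spanZ _ _ _) tens_fil_decr tens_fil_one tens_filM.

(* The identification [gr F \otimes gr G = gr (tens_fil F G)],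
   [[a]_i \otimes [b]_j |-> [a \otimes b]_(i + j)], see [gr_tens_pure]. *)
Definition gr_tens : gr F \otimes gr G -> gr tens_fil :=
  tens_ext (fun x y => gr_ext (fun i a => gr_ext (fun j b =>
    cls tens_fil (i + j) (a \otimes b)) y) x).

Lemma tens_fil_pure i j a b : F i a -> G j b -> tens_fil (i + j) (a \otimes b).
Proof. by move=> Fa Gb; apply: span_in; exists i, j, a, b. Qed.

Let tpureBl a a' b : (a - a') \otimes b = a \otimes b - a' \otimes b :> tens A B.
Proof. by apply/eqP; rewrite eq_sym subr_eq -tpureDl subrK. Qed.
Let tpureBr a b b' : a \otimes (b - b') = a \otimes b - a \otimes b' :> tens A B.
Proof. by apply/eqP; rewrite eq_sym subr_eq -tpureDr subrK. Qed.

Let term i a j b := cls tens_fil (i + j) (a \otimes b).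
Let gr_tens_termBr i a j b b' : F i a -> G j b -> G j b' ->
  term i a j (b - b') = term i a j b - term i a j b'.
Proof. by move=> Fa Gb Gb'; rewrite /term tpureBr clsB //; apply: tens_fil_pure. Qed.
Let gr_tens_termBl i a a' j b : F i a -> F i a' -> G j b ->
  term i (a - a') j b = term i a j b - term i a' j b.
Proof. by move=> Fa Gb Gb'; rewrite /term tpureBl clsB //; apply: tens_fil_pure. Qed.
Let gr_tens_term0r i a j b : F i a -> G (j + 1) b -> term i a j b = 0.
Proof.
move=> Fa Gb; apply/cls_eq0; first by apply/tens_fil_pure/fil_decr.
by rewrite -addrA; apply: tens_fil_pure.
Qed.
Let gr_tens_term0l i a j b : F (i + 1) a -> G j b -> term i a j b = 0.
Proof.
move=> Fa Gb; apply/cls_eq0; first by apply/tens_fil_pure => //; apply/fil_decr.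
by rewrite addrAC; apply: tens_fil_pure.
Qed.
Let gr_tens_termS i a j b (c : k) : F i a -> G j b ->
  term i (c%:S * a) j b = c%:S * term i a j b.
Proof. by move=> Fa Gb; rewrite /term tpureSl cls_scal //; apply: tens_fil_pure. Qed.

Let inner i a (y : gr G) := gr_ext (term i a) y.
Let gr_tens_innerE i a v : F i a ->
  inner i a (qpi (gr_ideal G) v) =
  \sum_(j <- finsupp (saval v)) term i a j (coef j (saval v)).
Proof.
move=> Fa; rewrite /inner gr_ext_qpi // => j b; first by move=> b'; apply: gr_tens_termBr.
exact: gr_tens_term0r.
Qed.
Let gr_tens_innerBl i a a' y : F i a -> F i a' ->
  inner i (a - a') y = inner i a y - inner i a' y.
Proof.
elim/(@qpi_ind k _ (gr_ideal G)): y => v Fa Fa'.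
rewrite !gr_tens_innerE //; last exact: filB.
by rewrite -sumrB; apply: eq_bigr => j _; apply: gr_tens_termBl => //; apply: (savalP v).
Qed.
Let gr_tens_inner0l i a y : F (i + 1) a -> inner i a y = 0.
Proof.
elim/(@qpi_ind k _ (gr_ideal G)): y => v Fa; rewrite gr_tens_innerE; last exact: fil_decr.
by apply: big1 => j _; apply: gr_tens_term0l => //; apply: (savalP v).
Qed.
Let gr_tens_innerB i a : F i a -> zmod_morphism (inner i a).
Proof.
move=> Fa; apply: gr_extB => j b; first by move=> b'; apply: gr_tens_termBr.
exact: gr_tens_term0r.
Qed.
Let outer (x : gr F) y := gr_ext (fun i a => inner i a y) x.
Let gr_tens_outerE u y : outer (qpi (gr_ideal F) u) y =
  \sum_(i <- finsupp (saval u)) inner i (coef i (saval u)) y.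
Proof.
by rewrite /outer gr_ext_qpi // => i a; [move=> a'; apply: gr_tens_innerBl | apply: gr_tens_inner0l].
Qed.
Let gr_tens_outerBl y : zmod_morphism (outer^~ y).
Proof. by apply: gr_extB => i a; [move=> a'; apply: gr_tens_innerBl | apply: gr_tens_inner0l]. Qed.
Let gr_tens_outerBr x : zmod_morphism (outer x).
Proof.
elim/(@qpi_ind k _ (gr_ideal F)): x => u y y'; rewrite !gr_tens_outerE -sumrB.
by apply: eq_bigr => i _; rewrite gr_tens_innerB //; apply: (savalP u).
Qed.
Let zmod_morphismD (U V : zmodType) (f : U -> V) :
  zmod_morphism f -> {morph f : x y / x + y}.
Proof.
move=> fB x y; have f0 : f 0 = 0 by rewrite -[0 in LHS](subrr 0) fB subrr.
by rewrite -[y in LHS]opprK fB -[- y]sub0r fB f0 sub0r opprK.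
Qed.

Let gr_tens_outer_cls i j a b : F i a -> G j b ->
  outer (cls F i a) (cls G j b) = cls tens_fil (i + j) (a \otimes b).
Proof.
move=> Fa Gb; rewrite /outer gr_ext_cls // => [|n x x'|n x]; last 2 first.
- exact: gr_tens_innerBl.
- exact: gr_tens_inner0l.
rewrite /inner gr_ext_cls // => [m x x'|m x]; first exact: gr_tens_termBr.
exact: gr_tens_term0r.
Qed.

Let gr_cls_sum (C : pzAlgType k) (K : filtration C) (y : gr K) :
  exists2 f : monalg C zdeg, forall m, K m (coef m f) &
    y = \sum_(m <- finsupp f) cls K m (coef m f).
Proof.
elim/(@qpi_ind k _ (gr_ideal K)): y => u; exists (saval u).
  exact: (savalP u).
rewrite -[LHS]/(qpi _ _).
transitivity (qpi (gr_ideal K) (\sum_(m <- finsupp (saval u))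
    insubd (0 : subalg (rees K)) (mon (m : zdeg) (coef m (saval u))))).
  congr (qpi _ _); apply: val_inj; rewrite /= raddf_sum /=.
  rewrite [LHS]monalgE /mext; apply: eq_bigr => m _.
  rewrite insubdK //; apply/asboolP => n; rewrite coef_mon.
  by case: eqP => [->|_]; [apply: (savalP u) | apply: fil0].
by rewrite raddf_sum.
Qed.

Lemma gr_tens_pure i j a b : F i a -> G j b ->
  gr_tens (cls F i a \otimes cls G j b) = cls tens_fil (i + j) (a \otimes b).
Proof.
move=> Fa Gb; rewrite -gr_tens_outer_cls //; rewrite /gr_tens.
have sumE (x : gr F) (y : gr G) : exists2 f : monalg A zdeg,
    forall m, F m (coef m f) & exists2 g : monalg B zdeg,
    forall m, G m (coef m g) &
    x = \sum_(m <- finsupp f) cls F m (coef m f) /\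
    y = \sum_(n <- finsupp g) cls G n (coef n g).
  have [f Ff ->] := gr_cls_sum x; have [g Gg ->] := gr_cls_sum y.
  by exists f => //; exists g.
pose ol y : {additive gr F -> gr tens_fil} := HB.pack (outer^~ y)
  (GRing.isZmodMorphism.Build _ _ _ (gr_tens_outerBl y)).
pose or x : {additive gr G -> gr tens_fil} := HB.pack (outer x)
  (GRing.isZmodMorphism.Build _ _ _ (gr_tens_outerBr x)).
have gr_tens_outerE2 (f : monalg A zdeg) (g : monalg B zdeg) (H : A -> A) (H' : B -> B) :
    outer (\sum_(m <- finsupp f) cls F m (H (coef m f)))
          (\sum_(n <- finsupp g) cls G n (H' (coef n g))) =
    \sum_(m <- finsupp f) \sum_(n <- finsupp g)
      outer (cls F m (H (coef m f))) (cls G n (H' (coef n g))).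
  rewrite -[LHS]/(ol _ _) raddf_sum; apply: eq_bigr => m _.
  by rewrite -[LHS]/(or _ _) raddf_sum.
rewrite (_ : (fun x => _) = outer) // tens_ext_pure // => [x x' y|x y y'|c x y|c x y].
- exact: (zmod_morphismD (gr_tens_outerBl y)).
- exact: (zmod_morphismD (gr_tens_outerBr x)).
- have [f Ff [g Gg [-> ->]]] := sumE x y.
  rewrite mulr_sumr; under eq_bigr do rewrite cls_scal //.
  rewrite (gr_tens_outerE2 f g (fun a => c%:S * a) id) (gr_tens_outerE2 f g id id) mulr_sumr.
  apply: eq_bigr => m _; rewrite mulr_sumr; apply: eq_bigr => n _.
  by rewrite !gr_tens_outer_cls //; [apply: gr_tens_termS | apply: filS].
- have [f Ff [g Gg [-> ->]]] := sumE x y.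
  rewrite mulr_sumr; under [X in outer _ X]eq_bigr do rewrite cls_scal //.
  rewrite (gr_tens_outerE2 f g id (fun a => c%:S * a)) (gr_tens_outerE2 f g id id) mulr_sumr.
  apply: eq_bigr => m _; rewrite mulr_sumr; apply: eq_bigr => n _.
  rewrite !gr_tens_outer_cls //; last exact: filS.
  by rewrite tpureSr cls_scal //; apply: tens_fil_pure.
Qed.

End TensorFiltration.
Arguments gr_tens {k A B} F G t : rename.

Section FreeGroup.
Context {T : choiceType}.

(* [(x, false)] is the generator [x] and [(x, true)] its inverse. *)
Definition letter := (T * bool)%type.
Implicit Types (l : letter) (w : seq letter).
Definition linv l : letter := (l.1, ~~ l.2).

Definition reduced w := sorted (fun l l' => l' != linv l) w.

Definition lcons l w :=
  if w is l' :: w' then if l' == linv l then w' else l :: w else [:: l].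
Definition wmul w w' := foldr lcons w' w.
Definition winv w := rev (map linv w).

Let linvK : involutive linv. Proof. by case=> x b; rewrite /linv /= negbK. Qed.

Let reduced_lcons l w : reduced w -> reduced (lcons l w).
Proof.
case: w => [//|l' w] /= lw; case: eqP => [_|/eqP ll'] /=; last by rewrite ll'.
exact: path_sorted lw.
Qed.
Let lconsK l w : reduced w -> lcons l (lcons (linv l) w) = w.
Proof.
case: w => [_|l' w] /=; first by rewrite eqxx.
rewrite linvK; case: eqP => [->|_] /=; last by rewrite eqxx.
by case: w => //= l2 w /andP[/negPf -> _].
Qed.
Fact reduced_mul w w' : reduced w' -> reduced (wmul w w').
Proof. by move=> rw'; elim: w => //= l w; apply: reduced_lcons. Qed.
Let wmul_lcons l w w' : reduced w -> reduced w' ->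
  wmul (lcons l w) w' = lcons l (wmul w w').
Proof.
case: w => //= l' w _ rw'; case: eqP => //= ->.
by rewrite lconsK //; apply: reduced_mul.
Qed.
Let wmulA w w' w'' : reduced w' -> reduced w'' ->
  wmul w (wmul w' w'') = wmul (wmul w w') w''.
Proof.
move=> rw' rw''; elim: w => //= l w ->.
by rewrite wmul_lcons //; apply: reduced_mul.
Qed.
Let wmul1 w : reduced w -> wmul w [::] = w.
Proof.
elim: w => //= l w IH lw; rewrite IH; last exact: path_sorted lw.
by case: w lw {IH} => //= l' w /andP[/negPf -> _].
Qed.
Fact reduced_inv w : reduced w -> reduced (winv w).
Proof.
rewrite /reduced /winv rev_sorted sorted_map.
apply: sub_sorted => l l' /=; apply: contraNneq => e.
by rewrite -[l']linvK -[linv l']linvK -e linvK.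
Qed.
Let wmulV w : reduced w -> wmul (winv w) w = [::].
Proof.
rewrite /wmul /winv; elim: w => //= l w IH lw.
rewrite rev_cons foldr_rcons /= linvK eqxx IH //; exact: path_sorted lw.
Qed.
Let winvK : involutive winv.
Proof.
by move=> w; rewrite /winv map_rev revK -map_comp (eq_map (g := id)) ?map_id.
Qed.

Record freegroup := FreeGroup { fg_word : seq letter; _ : reduced fg_word }.
HB.instance Definition _ := [isSub for fg_word].
HB.instance Definition _ := [Choice of freegroup by <:].

Lemma fg_reduced (u : freegroup) : reduced (fg_word u). Proof. by case: u. Qed.

Definition fg_one : freegroup := @FreeGroup [::] isT.
Definition fg_mul (u v : freegroup) : freegroup :=
  FreeGroup (reduced_mul (fg_word u) (fg_reduced v)).
Definition fg_inv (u : freegroup) : freegroup :=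
  FreeGroup (reduced_inv (fg_reduced u)).

Fact fg_mulA : associative fg_mul.
Proof. by move=> u v w; apply/val_inj/wmulA; apply: fg_reduced. Qed.
Fact fg_mul1 : left_id fg_one fg_mul.
Proof. by move=> u; apply: val_inj. Qed.
Fact fg_1mul : right_id fg_one fg_mul.
Proof. by move=> u; apply/val_inj/wmul1/fg_reduced. Qed.
Fact fg_mulV : left_inverse fg_one fg_inv fg_mul.
Proof. by move=> u; apply/val_inj/wmulV/fg_reduced. Qed.
Fact fg_Vmul : right_inverse fg_one fg_inv fg_mul.
Proof.
move=> u; rewrite -[X in fg_mul X _](_ : fg_inv (fg_inv u) = u) ?fg_mulV //.
by apply/val_inj/winvK.
Qed.
HB.instance Definition _ := isGroup.Build freegroup
  fg_mulA fg_mul1 fg_1mul fg_mulV fg_Vmul.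

Definition fg_gen (x : T) : freegroup := @FreeGroup [:: (x, false)] isT.

Section Lift.
Context {G : groupType} (phi : T -> G).

Definition fg_letter l : G := if l.2 then (phi l.1)^-1%g else phi l.1.
Definition fg_lift (u : freegroup) : G :=
  foldr (fun l g => fg_letter l * g)%g 1%g (fg_word u).

Let lift_lcons l w : foldr (fun l g => fg_letter l * g)%g 1%g (lcons l w) =
  (fg_letter l * foldr (fun l g => fg_letter l * g) 1 w)%g.
Proof.
case: w => //= l' w; case: eqP => //= ->.
by rewrite mulgA /fg_letter /=; case: l.2; rewrite ?mulVg ?mulgV mul1g.
Qed.

Lemma fg_liftM : {morph fg_lift : u v / (u * v)%g}.
Proof.
move=> u v; rewrite /fg_lift [fg_word _]/=; elim: (fg_word u) => /= [|l w IH].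
  by rewrite mul1g.
by rewrite lift_lcons IH mulgA.
Qed.
Lemma fg_lift1 : fg_lift 1%g = 1%g. Proof. by []. Qed.
Lemma fg_lift_gen x : fg_lift (fg_gen x) = phi x.
Proof. by rewrite /fg_lift /= mulg1. Qed.
End Lift.

End FreeGroup.
Arguments freegroup T : clear implicits.

(* Integer powers in a group. *)
Definition zexpg (G : groupType) (x : G) (n : int) : G :=
  match n with Posz n => (x ^+ n)%g | Negz n => ((x ^+ n.+1)^-1)%g end.

Section RootsOfUnity.
Context (R : realType) (N : nat).

(* The nonvanishing condition is redundant for [N > 0]; it makes [mu] a group
   for every [N]. *)
Definition mu_pred : pred R[i] := fun z => (z != 0) && (z ^+ N == 1).
Record mu := Mu { mu_val : R[i]; _ : mu_pred mu_val }.
HB.instance Definition _ := [isSub for mu_val].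
HB.instance Definition _ := [Choice of mu by <:].

Lemma muP (z : mu) : mu_pred (mu_val z). Proof. by case: z. Qed.

Fact mu_pred1 : mu_pred 1. Proof. by rewrite /mu_pred oner_eq0 expr1n eqxx. Qed.
Fact mu_predM (z w : mu) : mu_pred (mu_val z * mu_val w).
Proof.
have /andP[z0 /eqP zN] := muP z; have /andP[w0 /eqP wN] := muP w.
by rewrite /mu_pred mulf_neq0 //= exprMn zN wN mulr1.
Qed.
Fact mu_predV (z : mu) : mu_pred (mu_val z)^-1.
Proof.
have /andP[z0 /eqP zN] := muP z.
by rewrite /mu_pred invr_eq0 z0 /= exprVn zN invr1.
Qed.
Definition mu_one : mu := Mu mu_pred1.
Definition mu_mul (z w : mu) : mu := Mu (mu_predM z w).
Definition mu_inv (z : mu) : mu := Mu (mu_predV z).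

Fact mu_mulA : associative mu_mul.
Proof. by move=> x y z; apply: val_inj; rewrite /= mulrA. Qed.
Fact mu_mul1 : left_id mu_one mu_mul.
Proof. by move=> x; apply: val_inj; rewrite /= mul1r. Qed.
Fact mu_1mul : right_id mu_one mu_mul.
Proof. by move=> x; apply: val_inj; rewrite /= mulr1. Qed.
Fact mu_mulV : left_inverse mu_one mu_inv mu_mul.
Proof.
by move=> x; apply: val_inj; have /andP[x0 _] := muP x; rewrite /= mulVf.
Qed.
Fact mu_Vmul : right_inverse mu_one mu_inv mu_mul.
Proof.
by move=> x; apply: val_inj; have /andP[x0 _] := muP x; rewrite /= mulfV.
Qed.
HB.instance Definition _ := isGroup.Build mu
  mu_mulA mu_mul1 mu_1mul mu_mulV mu_Vmul.

(* [exp (i t)] *)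
Definition expi (t : R) : R[i] := (cos t +i* sin t)%C.
Lemma expiX t n : expi t ^+ n = expi (t *+ n).
Proof.
elim: n => [|n IH]; first by rewrite expr0 mulr0n /expi cos0 sin0.
rewrite exprS IH mulrS /expi cosD sinD; apply/eqP; rewrite eq_complex /=.
by rewrite eqxx /= addrC eqxx.
Qed.

Fact zeta_proof : mu_pred (expi (2 * pi / N%:R)).
Proof.
have zN : expi (2 * pi / N%:R) ^+ N = 1.
  have [->|N0] := eqVneq N 0%N; first by rewrite expr0.
  rewrite expiX (_ : _ *+ N = pi *+ 2); last first.
    by rewrite -[LHS]mulr_natr divfK ?pnatr_eq0 // mulr_natl.
  by rewrite /expi cos2pi sin2pi.
rewrite /mu_pred zN eqxx andbT.
rewrite eq_complex /=; apply/negP => /andP[/eqP c0 /eqP s0].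
have := cos2Dsin2 (2 * pi / N%:R : R).
by rewrite c0 s0 expr0n addr0 => /esym/eqP; rewrite oner_eq0.
Qed.
Definition zeta : mu := Mu zeta_proof.

End RootsOfUnity.

Section AdicFiltration.
Context {k : comPzRingType} {A : pzAlgType k}.

(* The [n]-th power of a submodule: the span of [n]-fold products. *)
Definition sub_pow (S : set A) (n : nat) : set A :=
  span [set x | exists2 f : 'I_n -> A, forall i, S (f i) &
    x = \prod_(i < n) f i]%classic.

Lemma sub_powM S m n x y : sub_pow S m x -> sub_pow S n y ->
  sub_pow S (m + n) (x * y).
Proof.
apply: spanM => _ _ [f Sf ->] [g Sg ->].
exists (fun i => match fintype.split i with inl j => f j | inr j => g j end).
  by move=> i; case: fintype.split.
rewrite big_split_ord /=; congr (_ * _); apply: eq_bigr => i _.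
  by rewrite (unsplitK (inl i)).
by rewrite (unsplitK (inr i)).
Qed.

Lemma sub_pow1 (S : set A) x : S x -> sub_pow S 1 x.
Proof. by move=> Sx; apply: span_in; exists (fun=> x); rewrite ?big_ord1. Qed.

Context (I : ideal A).

Let powMl n a x : sub_pow I n.+1 x -> sub_pow I n.+1 (a * x).
Proof.
apply: (span_le (P := fun x => sub_pow I n.+1 (a * x))).
- by rewrite mulr0; apply: span0.
- by move=> y z; rewrite mulrDr; apply: spanD.
- by move=> c y; rewrite mulrA -scalC -mulrA; apply: spanZ.
move=> _ [f If ->]; rewrite big_ord_recl mulrA; apply: span_in.
exists (fun i => if unlift ord0 i is Some j then f (lift ord0 j) else a * f ord0).
  by move=> i; case: unlift => [j|]; last apply: idealMl.
by rewrite big_ord_recl unlift_none; congr (_ * _); apply: eq_bigr => i _; rewrite liftK.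
Qed.
Let powMr n a x : sub_pow I n.+1 x -> sub_pow I n.+1 (x * a).
Proof.
apply: (span_le (P := fun x => sub_pow I n.+1 (x * a))).
- by rewrite mul0r; apply: span0.
- by move=> y z; rewrite mulrDl; apply: spanD.
- by move=> c y; rewrite -mulrA; apply: spanZ.
move=> _ [f If ->]; rewrite big_ord_recr -mulrA; apply: span_in.
exists (fun i => if unlift ord_max i is Some j then f (lift ord_max j) else f ord_max * a).
  by move=> i; case: unlift => [j|]; last apply: idealMr.
rewrite [RHS]big_ord_recr unlift_none; congr (_ * _); apply: eq_bigr => i _.
rewrite (_ : widen_ord (leqnSn n) i = lift ord_max i) ?liftK //.
by apply: val_inj; rewrite /= /bump leqNgt ltn_ord.
Qed.
Let pow_decr n x : sub_pow I n.+2 x -> sub_pow I n.+1 x.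
Proof.
apply: span_le; [exact: span0|move=> y z; exact: spanD|move=> c y; exact: spanZ|].
move=> _ [f If ->]; rewrite big_ord_recl; apply: powMl; apply: span_in.
by exists (fun i => f (lift ord0 i)).
Qed.
Let pow_le p q x : (0 < q <= p)%N -> sub_pow I p x -> sub_pow I q x.
Proof.
case/andP; case: q => // q _ /subnK <-; elim: (p - q.+1)%N => // n IH px.
by apply: IH; rewrite addnS; apply: pow_decr; rewrite -addnS addSn in px *.
Qed.

Definition adic_set (m : int) : set A :=
  if m <= 0 then setT else sub_pow I `|m|%N.

Let adicP m x : adic_set m x <-> (0 < m -> sub_pow I `|m|%N x).
Proof. by rewrite /adic_set leNgt; case: (0 < m); split=> // h; apply: h. Qed.

Fact adic0 m : adic_set m 0.
Proof. by apply/adicP => _; apply: span0. Qed.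
Fact adicD m x y : adic_set m x -> adic_set m y -> adic_set m (x + y).
Proof.
by move=> /adicP hx /adicP hy; apply/adicP => m0; apply: spanD; [apply: hx|apply: hy].
Qed.
Fact adicS m (c : k) x : adic_set m x -> adic_set m (c%:S * x).
Proof. by move=> /adicP hx; apply/adicP => m0; apply/spanZ/hx. Qed.
Let adic_le m n x : m <= n -> adic_set n x -> adic_set m x.
Proof.
move=> mn /adicP hx; apply/adicP => m0; have n0 := lt_le_trans m0 mn.
apply: pow_le (hx n0); case: m n {hx} mn m0 n0 => [m|m] [n|n] //=.
by rewrite lez_nat ltz_nat => -> ->.
Qed.
Fact adic_decr m x : adic_set (m + 1) x -> adic_set m x.
Proof. by apply: adic_le; rewrite lerDl. Qed.
Fact adic1 : adic_set 0 1. Proof. by []. Qed.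
Fact adicM m n x y : adic_set m x -> adic_set n y -> adic_set (m + n) (x * y).
Proof.
have [m0|m0] := leP m 0.
  move=> _ hy; apply: (@adic_le _ n); first by rewrite gerDr.
  move/adicP: hy => hy; apply/adicP => n0; have := hy n0.
  by case: n n0 {hy} => [[|n]|n] //= _; apply: powMl.
have [n0|n0] := leP n 0.
  move=> hx _; apply: (@adic_le _ m); first by rewrite gerDl.
  move/adicP: hx => hx; apply/adicP => n1; have := hx n1.
  by case: m m0 n1 {hx} => [[|m]|m] //= _ _; apply: powMr.
move=> /adicP/(_ m0) hx /adicP/(_ n0) hy; apply/adicP => _.
case: m n m0 n0 hx hy => [m|m] [n|n] //= _ _.
exact: sub_powM.
Qed.

(* [F^m = A] for [m <= 0] and [F^m = I^m] for [m > 0]. *)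
Definition adic_filtration : filtration A :=
  Filtration adic0 adicD adicS adic_decr adic1 adicM.

End AdicFiltration.

Section SubalgebraFiltration.
Context {k : comPzRingType} {A : pzAlgType k} (F : filtration A)
  (S : subalgebra A).

Definition fil_restr_set (m : int) : set (subalg S) := fun u => F m (saval u).
Fact fil_restr0 m : fil_restr_set m 0. Proof. exact: fil0. Qed.
Fact fil_restrD m u v :
  fil_restr_set m u -> fil_restr_set m v -> fil_restr_set m (u + v).
Proof. exact: filD. Qed.
Fact fil_restrS m (c : k) u : fil_restr_set m u -> fil_restr_set m (c%:S * u).
Proof. exact: filS. Qed.
Fact fil_restr_decr m u : fil_restr_set (m + 1) u -> fil_restr_set m u.
Proof. exact: fil_decr. Qed.
Fact fil_restr1 : fil_restr_set 0 1. Proof. exact: fil_one. Qed.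
Fact fil_restrM m n u v :
  fil_restr_set m u -> fil_restr_set n v -> fil_restr_set (m + n) (u * v).
Proof. exact: filM. Qed.

(* [F^m S = S \cap F^m A] *)
Definition fil_restr : filtration (subalg S) :=
  Filtration fil_restr0 fil_restrD fil_restrS fil_restr_decr fil_restr1
    fil_restrM.
End SubalgebraFiltration.

Section ScalarsPlusLeftIdeal.
Context {k : comPzRingType} {A : pzAlgType k} (w : A).

Definition scal_plus_set (x : A) : Prop :=
  exists (c : k) (v : A), x = c%:S + v * w.
Fact scal_plusS (c : k) : scal_plus_set c%:S.
Proof. by exists c, 0; rewrite mul0r addr0. Qed.
Fact scal_plusB x y : scal_plus_set x -> scal_plus_set y -> scal_plus_set (x - y).
Proof.
move=> [c [v ->]] [d [u ->]]; exists (c - d), (v - u).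
by rewrite raddfB mulrBl opprD addrACA.
Qed.
Fact scal_plusM x y : scal_plus_set x -> scal_plus_set y -> scal_plus_set (x * y).
Proof.
move=> [c [v ->]] [d [u ->]].
exists (c * d), (c%:S * u + d%:S * v + v * w * u).
rewrite rmorphM !mulrDl !mulrDr -!addrA !mulrA; congr (_ + (_ + (_ + _))).
by rewrite -scalC mulrA.
Qed.

(* [k + A w] *)
Definition scal_plus : subalgebra A := Subalgebra scal_plusS scal_plusB scal_plusM.

Fact scal_plus_mul v : scal_plus (v * w).
Proof. by exists 0, v; rewrite raddf0 add0r. Qed.
End ScalarsPlusLeftIdeal.

(* [f p + ... + f q] if [q > p - 1], [0] if [q = p - 1] and
   [- f (p - 1) - ... - f (q + 1)] if [q < p - 1]. *)
Definition sumz (V : zmodType) (p q : int) (f : int -> V) : V :=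
  if p - 1 <= q then \sum_(i < absz (q - (p - 1))%R) f (p + i%:Z)
  else - \sum_(i < absz ((p - 1) - q)%R) f (q + 1 + i%:Z).

Notation F2 := (freegroup bool).

Section Betti.
Context (k : comPzRingType).

Definition X0 : F2 := fg_gen false.
Definition X1 : F2 := fg_gen true.

Definition VB := monalg k^o F2.
HB.instance Definition _ := PzAlgebra.on VB.
Definition grp (g : F2) : VB := mon g (1 : k^o).

Definition WB_sub : subalgebra VB := scal_plus (grp X1 - 1).
Definition WB := subalg WB_sub.
HB.instance Definition _ := PzAlgebra.on WB.

Fact WB_X1V : WB_sub (grp X1^-1%g).
Proof.
exists 1, (- grp X1^-1%g).
rewrite rmorph1 mulrBr mulr1 opprK /grp mulNr monM mulVg mulr1 -[mon 1%g _]mon1.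
by rewrite addrA addrN add0r.
Qed.
Definition X1V : WB := inS WB_X1V.

(* [X_0^n (X_1 - 1)] *)
Definition X0nX1 (n : int) : WB :=
  inS (scal_plus_mul (grp X1 - 1) (grp (zexpg X0 n)) : WB_sub _).

Definition is_betti_coproduct (D : WB -> WB \otimes WB) : Prop :=
  D X1V = (X1V \otimes 1) * (1 \otimes X1V) /\
  forall n : int, D (X0nX1 n) = X0nX1 n \otimes 1 + 1 \otimes X0nX1 n -
    sumz 1 (n - 1) (fun j => (X0nX1 j \otimes 1) * (1 \otimes X0nX1 (n - j))).

Context (R : realType) (N : nat).

Definition F2_to_mu : F2 -> mu R N :=
  fg_lift (fun b : bool => if b then 1%g else zeta R N).

Definition IN_set (x : VB) : Prop := monalg_map F2_to_mu x = 0.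
Let phi_M (x y : VB) :
  monalg_map F2_to_mu (x * y) = monalg_map F2_to_mu x * monalg_map F2_to_mu y.
Proof. by apply: monalg_mapM => //; apply: fg_liftM. Qed.
Fact IN0 : IN_set 0. Proof. by rewrite /IN_set /monalg_map /mext finsupp0 big_seq_fset0. Qed.
Fact IND x y : IN_set x -> IN_set y -> IN_set (x + y).
Proof.
rewrite /IN_set => hx hy; rewrite -[y]opprK monalg_mapB hx -[- y]sub0r monalg_mapB.
by rewrite hy IN0 !subr0.
Qed.
Fact INMl a x : IN_set x -> IN_set (a * x).
Proof. by rewrite /IN_set phi_M => ->; rewrite mulr0. Qed.
Fact INMr a x : IN_set x -> IN_set (x * a).
Proof. by rewrite /IN_set phi_M => ->; rewrite mul0r. Qed.
Definition IN : ideal VB := Ideal IN0 IND INMl INMr.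

Definition VB_fil : filtration VB := adic_filtration IN.
Definition WB_fil : filtration WB := fil_restr VB_fil WB_sub.

Lemma grp_sub_in_fil1 g h : F2_to_mu g = F2_to_mu h -> VB_fil 1 (grp g - grp h).
Proof.
move=> gh; apply/sub_pow1; rewrite /= /IN_set monalg_mapB !monalg_map_mon gh.
exact: subrr.
Qed.

Lemma X1_sub1_in_fil1 : VB_fil 1 (grp X1 - 1).
Proof. by apply: (@grp_sub_in_fil1 X1 1%g); rewrite /F2_to_mu fg_lift_gen. Qed.

Lemma X0N_sub1_in_fil1 : VB_fil 1 (grp (X0 ^+ N)%g - 1).
Proof.
apply: (@grp_sub_in_fil1 (X0 ^+ N)%g 1%g).
have -> n : F2_to_mu (X0 ^+ n)%g = (zeta R N ^+ n)%g.
  elim: n => [//|n IH]; rewrite !expgS -IH /F2_to_mu fg_liftM fg_lift_gen //.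
apply: val_inj; have -> n : val (zeta R N ^+ n)%g = val (zeta R N) ^+ n.
  by elim: n => [//|n IH]; rewrite expgS exprS -IH.
by have /andP[_ /eqP] := muP (zeta R N).
Qed.

End Betti.

(* Free monoids. *)
Definition word (T : choiceType) := seq T.
HB.instance Definition _ (T : choiceType) := Choice.on (word T).
HB.instance Definition _ (T : choiceType) :=
  isMonoid.Build (word T) (@catA T) (@cat0s T) (@cats0 T).

Section DeRham.
Context (k : comPzRingType) (R : realType) (N : nat).

(* The generators are [e_0 = inl false], [e_1 = inl true] and [z = inr z]. *)
Definition dr_gen := (bool + mu R N)%type.
HB.instance Definition _ := Choice.on dr_gen.
Definition dr_free := monalg k^o (word dr_gen).
HB.instance Definition _ := PzAlgebra.on dr_free.
Definition dr_var (x : dr_gen) : dr_free := mon ([:: x] : word dr_gen) (1 : k^o).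

Inductive dr_rel : set dr_free :=
| dr_rel_mul z y : dr_rel (dr_var (inr z) * dr_var (inr y) - dr_var (inr (z * y)%g))
| dr_rel_one : dr_rel (dr_var (inr 1%g) - 1)
| dr_rel_comm z : dr_rel (dr_var (inr z) * dr_var (inl false) -
    dr_var (inl false) * dr_var (inr z)).

Definition VDR := quotalg (gen_ideal dr_rel).
HB.instance Definition _ := PzAlgebra.on VDR.
Definition e0 : VDR := qpi (gen_ideal dr_rel) (dr_var (inl false)).
Definition e1 : VDR := qpi (gen_ideal dr_rel) (dr_var (inl true)).
Definition dr_mu (z : mu R N) : VDR := qpi (gen_ideal dr_rel) (dr_var (inr z)).

Definition word_deg (w : word dr_gen) : nat :=
  count (fun x : dr_gen => if x is inl _ then true else false) w.
Definition VDR_deg (n : int) : set VDR :=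
  span [set x | exists2 w : word dr_gen, (word_deg w)%:Z = n &
    x = qpi (gen_ideal dr_rel) (mon w (1 : k^o))]%classic.

Definition WDR_sub : subalgebra VDR := scal_plus e1.
Definition WDR := subalg WDR_sub.
HB.instance Definition _ := PzAlgebra.on WDR.

(* [z_(n, z) = - e_0^(n - 1) z e_1], for [n > 0] *)
Definition zW (n : nat) (z : mu R N) : WDR :=
  inS (scal_plus_mul e1 (- (e0 ^+ n.-1 * dr_mu z)) : WDR_sub _).

Definition is_dr_coproduct (D : WDR -> WDR \otimes WDR) : Prop :=
  forall (n : nat) (z : mu R N), (0 < n)%N ->
    D (zW n z) = zW n z \otimes 1 + 1 \otimes zW n z +
      \sum_(1 <= j < n) \sum_(y \in [set: mu R N])
        zW j y \otimes zW (n - j) (z * y^-1)%g.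

Definition is_rhoV (rho : VDR -> gr (VB_fil k R N)) : Prop :=
  [/\ bijective rho, forall n x, VDR_deg n x -> gr_deg n (rho x),
   rho (dr_mu (zeta R N)) = cls (VB_fil k R N) 0 (grp k X0),
   rho e0 = cls (VB_fil k R N) 1 (grp k (X0 ^+ N)%g - 1) &
   rho e1 = cls (VB_fil k R N) 1 (grp k X1 - 1)].

(* [rhoW] is the restriction of [rhoV], [gr WB] being viewed in [gr VB] through
   the map induced by the inclusion. *)
Definition is_rhoW (rhoV : VDR -> gr (VB_fil k R N))
    (rhoW : WDR -> gr (WB_fil k R N)) : Prop :=
  forall w : WDR,
    gr_map (VB_fil k R N) (saval : WB k -> VB k) (rhoW w) = rhoV (saval w).

End DeRham.

(* Main.v *)
(* Both sides are algebra morphisms, so it suffices to compare them on the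
   generators [z_(n + 1, zeta_N^a)], [1 <= a <= N], which [rho] sends to minus the
   class of [u_(n, a) = (X_0^N - 1)^n X_0^a (X_1 - 1)].  From
   [u_(n + 1, a) = u_(n, N + a) - u_(n, a)] one gets by induction on [n]
     [Delta u_(n, a) = u_(n, a) (x) 1 + 1 (x) u_(n, a)
        - \sum_(1 <= b < a) u_(n, b) (x) u_(0, a - b)
        - \sum_(j < n) \sum_(1 <= b <= N) u_(j, b) (x) u_(n - 1 - j, N + a - b)].
   The first sum lies in [F^(n + 2)], so it vanishes in degree [n + 1], and the
   second one is the de Rham coproduct since [zeta_N^(N + a - b)] is
   [zeta_N^a (zeta_N^b)^-1]. *)
Require Import Defs.
From mathcomp Require Import all_boot all_order all_algebra finmap.
From mathcomp Require Import generic_quotient complex.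
From mathcomp Require Import boolp classical_sets fsbigop reals trigo.
From mathcomp Require Import zify lra.

Set Implicit Arguments.
Unset Strict Implicit.
Unset Printing Implicit Defensive.

Import Order.TTheory GRing.Theory Num.Theory.
Local Open Scope ring_scope.

(** * Additive maps between abelian groups *)

Section ZmodMorphism.
Context {U V : zmodType} {f : U -> V} (fB : zmod_morphism f).

Lemma zmod_morphism0 : f 0 = 0.
Proof. by rewrite -[0 in LHS](subrr 0) fB subrr. Qed.

Lemma zmod_morphismD : {morph f : x y / x + y}.
Proof.
by move=> x y; rewrite -[y in LHS]opprK fB -[- y]sub0r fB zmod_morphism0 sub0r opprK.
Qed.

Lemma zmod_morphismN : {morph f : x / - x}.
Proof. by move=> x; rewrite -sub0r fB zmod_morphism0 sub0r. Qed.

Lemma zmod_morphism_sum (T : Type) (r : seq T) (G : T -> U) :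
  f (\sum_(i <- r) G i) = \sum_(i <- r) f (G i).
Proof. exact: (big_morph f zmod_morphismD zmod_morphism0). Qed.
End ZmodMorphism.

(** * Classes in an associated graded algebra *)

Section AssociatedGradedTheory.
Context {k : comPzRingType} {A : pzAlgType k} (F : filtration A).

Lemma clsD m x y : F m x -> F m y -> cls F m (x + y) = cls F m x + cls F m y.
Proof.
move=> Fx Fy; rewrite !clsE //; [exact: filD|] => Fxy.
by rewrite -raddfD; congr (qpi _ _); apply: val_inj; rewrite /= raddfD.
Qed.

Lemma cls0 m : cls F m 0 = 0.
Proof. by apply/cls_eq0; apply: fil0. Qed.

Lemma fil_sum m (T : Type) (r : seq T) (P : pred T) (G : T -> A) :
  (forall i, P i -> F m (G i)) -> F m (\sum_(i <- r | P i) G i).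
Proof. by move=> FG; elim/big_ind: _ => //; [apply: fil0 | apply: filD]. Qed.

Lemma cls_sum m (T : eqType) (r : seq T) (G : T -> A) :
  (forall i, i \in r -> F m (G i)) ->
  cls F m (\sum_(i <- r) G i) = \sum_(i <- r) cls F m (G i).
Proof.
elim: r => [|i r IH] FG; first by rewrite !big_nil cls0.
rewrite !big_cons clsD ?IH //; first by move=> j jr; apply: FG; rewrite inE jr orbT.
  by apply: FG; rewrite inE eqxx.
by rewrite big_seq; apply: fil_sum => j jr; apply: FG; rewrite inE jr orbT.
Qed.

Lemma cls1 : cls F 0 1 = 1.
Proof.
rewrite clsE; first exact: fil_one.
move=> F1; rewrite -(rmorph1 (qpi (gr_ideal F))); congr (qpi _ _).
by apply: val_inj.
Qed.

Lemma cls_scal1 c : cls F 0 c%:S = c%:S.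
Proof. by rewrite -[c%:S in LHS]mulr1 -cls_scal ?cls1 ?mulr1 //; apply: fil_one. Qed.

(** A representative in the Rees algebra is the finite sum of its homogeneous components. Zero needs
    no case of its own, being [cls F 0 0]. *)
Lemma gr_ind (P : gr F -> Prop) :
  (forall x y, P x -> P y -> P (x + y)) ->
  (forall m x, F m x -> P (cls F m x)) -> forall y, P y.
Proof.
move=> PD PC; elim/(@qpi_ind k _ (gr_ideal F)) => u.
have -> : u = \sum_(m <- finsupp (saval u))
    insubd (0 : subalg (rees F)) (mon (m : zdeg) (coef m (saval u))).
  apply: val_inj; rewrite /= raddf_sum /= [LHS]monalgE /mext.
  apply: eq_bigr => m _; rewrite insubdK //; apply/asboolP/rees_mon.
  exact: (savalP u).
rewrite raddf_sum; elim/big_ind: _ => //=.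
  by rewrite -(cls0 0); apply/PC/fil0.
by move=> m _; apply/PC/(savalP u).
Qed.

End AssociatedGradedTheory.

(** * Graded maps induced by filtered morphisms *)

Section GradedMap.
Context {k : comPzRingType} {A B : pzAlgType k} (F : filtration A)
  (G : filtration B) (f : {alghom A -> B}).
Hypothesis fP : filtered_map F G f.

Lemma gr_mapB : zmod_morphism (gr_map (F := F) G f).
Proof.
apply: gr_extB => m x; first by move=> y Fx Fy; rewrite raddfB clsB //; apply: fP.
by move=> Fx; apply/cls_eq0; [apply/fP/fil_decr | apply: fP].
Qed.

Lemma gr_mapM : {morph gr_map (F := F) G f : x y / x * y}.
Proof.
have D := zmod_morphismD gr_mapB.
elim/(@gr_ind k) => [x x' IH IH' y|m x Fx]; first by rewrite mulrDl !D IH IH' mulrDl.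
elim/(@gr_ind k) => [y y' IH IH'|n y Fy]; first by rewrite mulrDr !D IH IH' mulrDr.
rewrite clsM // !gr_map_cls ?clsM ?rmorphM //; try exact: fP; exact: filM.
Qed.

Lemma gr_map_scal c : gr_map (F := F) G f c%:S = c%:S.
Proof.
rewrite -!cls_scal1 gr_map_cls ?ahom_scal //.
by rewrite -[c%:S]mulr1; apply/filS/fil_one.
Qed.
End GradedMap.

(** Strictness: as [F] is the preimage of [G], a class killed by the map has its representative one
    step further in [F]. The inclusion of [WB] in [VB] is of this kind, its filtration being the
    restricted one. *)
Lemma gr_map_inj (k : comPzRingType) (A B : pzAlgType k) (F : filtration A)
    (G : filtration B) (f : {alghom A -> B}) :
  (forall m x, G m (f x) <-> F m x) -> injective (gr_map (F := F) G f).
Proof.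
move=> fP; have fF : filtered_map F G f by move=> m x /fP.
suff K0 y : gr_map (F := F) G f y = 0 -> y = 0.
  move=> x y /eqP; rewrite -subr_eq0 -gr_mapB // => /eqP/K0/eqP.
  by rewrite subr_eq0 => /eqP.
elim/(@qpi_ind k _ (gr_ideal F)): y => u.
rewrite /gr_map gr_ext_qpi; last 2 first.
- by move=> m x y Fx Fy; rewrite raddfB clsB //; apply: fF.
- by move=> m x Fx; apply/cls_eq0; [apply/fF/fil_decr | apply: fF].
rewrite /mext -raddf_sum => /qpi_eq0 Ju; apply/qpi_eq0 => m; apply/fP.
have := Ju m; rewrite !raddf_sum /=.
have [mu|mu _] := boolP (m \in finsupp (saval u)); last first.
  by rewrite coefN0 // raddf0; apply: fil0.
have E n : coef m (saval (insubd (0 : subalg (rees G))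
    (mon (n : zdeg) (f (coef n (saval u)))))) =
    if m == n then f (coef n (saval u)) else 0.
  rewrite insubdK ?coef_mon //; apply/asboolP/rees_mon/fP.
  exact: (savalP u).
rewrite (big_fsetD1 m) //= E eqxx big1_fset ?addr0 // => n.
by rewrite in_fsetD1 E eq_sym; case: eqP.
Qed.

(** * Tensor products and their functoriality *)

Section TensorAlgebra.
Context {k : comPzRingType} {A B : pzAlgType k}.

(** The coefficient of a pure tensor is absorbed into its left factor, and zero is [0 \otimes 0]. *)
Lemma tens_ind (P : A \otimes B -> Prop) :
  (forall x y, P x -> P y -> P (x + y)) -> (forall a b, P (a \otimes b)) ->
  forall t, P t.
Proof.
move=> PD PP; elim/(@qpi_ind k _ (tens_ideal A B)) => x.
elim/(@monalg_ind (tpair A B) k^o): x => [|x y Px Py|[a b] c].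
- suff -> : qpi (tens_ideal A B) 0 = 0 \otimes 0 by [].
  by rewrite raddf0 -[0 in X in _ = X \otimes _](mulr0 0%:S) tpureSl raddf0 mul0r.
- by rewrite raddfD; apply: PD.
suff -> : qpi (tens_ideal A B) (mon ((a, b) : tpair A B) c) = ((c : k)%:S * a) \otimes b by [].
rewrite tpureSl -[RHS](rmorphM (qpi (tens_ideal A B)) (c : k)%:S).
by rewrite /tgen scal_mon /= mulr1.
Qed.

Lemma tpureBl (a a' : A) (b : B) : (a - a') \otimes b = a \otimes b - a' \otimes b.
Proof. by apply/eqP; rewrite eq_sym subr_eq -tpureDl subrK. Qed.
Lemma tpureBr (a : A) (b b' : B) : a \otimes (b - b') = a \otimes b - a \otimes b'.
Proof. by apply/eqP; rewrite eq_sym subr_eq -tpureDr subrK. Qed.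

Lemma tpure0l (b : B) : (0 : A) \otimes b = 0.
Proof. by rewrite -(subrr 0) tpureBl subrr. Qed.
Lemma tpure0r (a : A) : a \otimes (0 : B) = 0.
Proof. by rewrite -(subrr 0) tpureBr subrr. Qed.
Lemma tpureNl (a : A) (b : B) : (- a) \otimes b = - (a \otimes b).
Proof. by rewrite -sub0r tpureBl tpure0l sub0r. Qed.
Lemma tpureNr (a : A) (b : B) : a \otimes (- b) = - (a \otimes b).
Proof. by rewrite -sub0r tpureBr tpure0r sub0r. Qed.

Lemma tpure_scal1 (c : k) : c%:S \otimes 1 = c%:S :> A \otimes B.
Proof. by rewrite -[c%:S in LHS]mulr1 tpureSl tpure1 mulr1. Qed.
End TensorAlgebra.

Section TensorMap.
Context {k : comPzRingType} {A B A' B' : pzAlgType k}.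
Context (f : {alghom A -> A'}) (g : {alghom B -> B'}).

Lemma tens_mapB : zmod_morphism (tens_map f g).
Proof.
apply: tens_extB => [x y z|x y z|c x y|c x y].
- by rewrite raddfD tpureDl.
- by rewrite raddfD tpureDr.
- by rewrite rmorphM /= ahom_scal tpureSl.
- by rewrite rmorphM /= ahom_scal tpureSr.
Qed.

Lemma tens_mapM : {morph tens_map f g : x y / x * y}.
Proof.
have D := zmod_morphismD tens_mapB.
elim/(@tens_ind k) => [x x' IH IH' y|a b]; first by rewrite mulrDl !D IH IH' mulrDl.
elim/(@tens_ind k) => [y y' IH IH'|a' b']; first by rewrite mulrDr !D IH IH' mulrDr.
by rewrite tpureM !tens_map_pure tpureM !rmorphM.
Qed.

Lemma tens_map_scal c : tens_map f g c%:S = c%:S.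
Proof. by rewrite -!tpure_scal1 tens_map_pure ahom_scal rmorph1. Qed.
End TensorMap.

(** * [gr_tens] is an algebra morphism *)

Section GradedTensor.
Context {k : comPzRingType} {A B : pzAlgType k}.
Context (F : filtration A) (G : filtration B).
Notation T := (tens_fil F G).

(** [term], [inner] and [outer] rebuild in stages the bilinear map underlying [gr_tens]: extend
    first in the class of [b], then in that of [a]. *)
Let term i a j b := cls T (i + j) (a \otimes b).
Let inner i a (y : gr G) := gr_ext (term i a) y.
Let outer (x : gr F) (y : gr G) := gr_ext (fun i a => inner i a y) x.

Let inner_wd i a : F i a ->
  (forall j b b', G j b -> G j b' -> term i a j (b - b') = term i a j b - term i a j b')
  /\ (forall j b, G (j + 1) b -> term i a j b = 0).
Proof.
move=> Fa; split=> [j b b' Gb Gb'|j b Gb].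
  by rewrite /term tpureBr clsB //; apply: tens_fil_pure.
apply/cls_eq0; first by apply/tens_fil_pure/fil_decr.
by rewrite -addrA; apply: tens_fil_pure.
Qed.

Let innerB i a : F i a -> zmod_morphism (inner i a).
Proof. by move=> Fa; apply: gr_extB => j b; have [h1 h2] := inner_wd Fa; auto. Qed.

Let inner_cls i a j b : F i a -> G j b -> inner i a (cls G j b) = term i a j b.
Proof.
by move=> Fa Gb; have [h1 h2] := inner_wd Fa; apply: gr_ext_cls.
Qed.

(** These are the two conditions for [gr_ext] to descend to [gr F]. As [inner] is additive in [y],
    homogeneous [y] suffice. *)
Let outer_wd y :
  (forall i a a', F i a -> F i a' -> inner i (a - a') y = inner i a y - inner i a' y)
  /\ (forall i a, F (i + 1) a -> inner i a y = 0).
Proof.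
elim/(@gr_ind k): y => [y y' [h1 h2] [h1' h2']|j b Gb]; split=> i a.
- move=> a' Fa Fa'; rewrite !(zmod_morphismD (innerB _)) ?h1 ?h1' //; last exact: filB.
  by rewrite opprD addrACA.
- by move=> Fa; rewrite (zmod_morphismD (innerB (fil_decr Fa))) h2 // h2' // addr0.
- move=> a' Fa Fa'; rewrite !inner_cls //; last exact: filB.
  by rewrite /term tpureBl clsB //; apply: tens_fil_pure.
move=> Fa; rewrite inner_cls //; last exact: fil_decr.
apply/cls_eq0; first by apply/tens_fil_pure => //; apply: fil_decr.
by rewrite addrAC; apply: tens_fil_pure.
Qed.

Let outerBl y : zmod_morphism (outer^~ y).
Proof. by apply: gr_extB => i a; have [h1 h2] := outer_wd y; auto. Qed.

Let outerEl i a y : F i a -> outer (cls F i a) y = inner i a y.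
Proof.
by move=> Fa; have [h1 h2] := outer_wd y; rewrite /outer gr_ext_cls.
Qed.

Let outerBr x : zmod_morphism (outer x).
Proof.
move=> y y'; elim/(@gr_ind k): x => [x x' IH IH'|i a Fa].
  by rewrite !(zmod_morphismD (outerBl _)) IH IH' opprD addrACA.
by rewrite !outerEl // innerB.
Qed.

Lemma gr_tensB : zmod_morphism (gr_tens F G).
Proof.
have Dl y := zmod_morphismD (outerBl y); have Dr x := zmod_morphismD (outerBr x).
apply: (@tens_extB k _ _ _ outer) => // [x x' y|c x y|c x y]; first exact: Dl.
  elim/(@gr_ind k): x => [x x' IH IH'|i a Fa]; first by rewrite mulrDr !Dl IH IH' mulrDr.
  elim/(@gr_ind k): y => [y y' IH IH'|j b Gb]; first by rewrite !Dr IH IH' mulrDr.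
  rewrite cls_scal // !outerEl ?inner_cls //; try exact: filS.
  by rewrite /term tpureSl cls_scal //; apply: tens_fil_pure.
elim/(@gr_ind k): x => [x x' IH IH'|i a Fa]; first by rewrite !Dl IH IH' mulrDr.
elim/(@gr_ind k): y => [y y' IH IH'|j b Gb]; first by rewrite mulrDr !Dr IH IH' mulrDr.
rewrite cls_scal // !outerEl ?inner_cls //; try exact: filS.
by rewrite /term tpureSr cls_scal //; apply: tens_fil_pure.
Qed.

(** Multiplicativity is stable under sums in either argument, which leaves pure tensors of
    homogeneous classes. *)
Lemma gr_tensM : {morph gr_tens F G : x y / x * y}.
Proof.
have D := zmod_morphismD gr_tensB.
pose M x y := gr_tens F G (x * y) = gr_tens F G x * gr_tens F G y.
have Ml x x' y : M x y -> M x' y -> M (x + x') y.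
  by rewrite /M => h h'; rewrite mulrDl !D h h' mulrDl.
have Mr x y y' : M x y -> M x y' -> M x (y + y').
  by rewrite /M => h h'; rewrite mulrDr !D h h' mulrDr.
elim/(@tens_ind k) => [x x' IH IH' y|a b]; first exact: Ml.
elim/(@tens_ind k) => [y y'|a' b']; first exact: Mr.
elim/(@gr_ind k): a => [x x' IH IH'|i a Fa];
  first by rewrite tpureDl; apply: (Ml _ _ _ IH IH').
elim/(@gr_ind k): b => [x x' IH IH'|j b Gb];
  first by rewrite tpureDr; apply: (Ml _ _ _ IH IH').
elim/(@gr_ind k): a' => [x x' IH IH'|i' a' Fa'];
  first by rewrite tpureDl; apply: (Mr _ _ _ IH IH').
elim/(@gr_ind k): b' => [x x' IH IH'|j' b' Gb'];
  first by rewrite tpureDr; apply: (Mr _ _ _ IH IH').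
rewrite tpureM (clsM Fa Fa') (clsM Gb Gb').
apply: (etrans (gr_tens_pure (filM Fa Fa') (filM Gb Gb'))).
apply: (etrans _ (esym (f_equal2 *%R (gr_tens_pure Fa Gb) (gr_tens_pure Fa' Gb')))).
rewrite (clsM (tens_fil_pure Fa Gb) (tens_fil_pure Fa' Gb')) tpureM.
(* Both degrees agree: [(i + i') + (j + j') = (i + j) + (i' + j')]. *)
by congr (cls _ _ _); rewrite addrACA.
Qed.

Lemma gr_tens_scal c : gr_tens F G c%:S = c%:S.
Proof.
rewrite -tpure_scal1 -!cls_scal1 -cls1 gr_tens_pure ?tpure_scal1 //; try exact: fil_one.
by rewrite -[c%:S]mulr1; apply/filS/fil_one.
Qed.
End GradedTensor.

(** * Enumeration of [mu_N] by powers of [zeta_N] *)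

Section RootsOfUnityTheory.
Context (R : realType) (N : nat) (N_gt0 : (0 < N)%N).
Notation zeta := (zeta R N).

Lemma mu_valX (z : mu R N) n : mu_val (z ^+ n)%g = mu_val z ^+ n.
Proof. by elim: n => [//|n IH]; rewrite expgS exprS -IH. Qed.

Lemma zeta_prim : N.-primitive_root (mu_val zeta).
Proof.
apply/andP; split=> //; apply/forallP => i; rewrite unity_rootE /=.
have [->|iN] := eqVneq i.+1 N; first by have /andP[_ ->] := muP zeta.
have {}iN : (i.+1 < N)%N by rewrite ltn_neqAle iN /=.
rewrite expiX eqbF_neg eq_complex /= negb_and.
have N0 : 0 < N%:R :> R by rewrite ltr0n.
(* Half of the angle, which for a proper power lies strictly between 0 and [pi]. Hence [sin t > 0],
   and the real part [cos (2 t) = 1 - 2 sin^2 t] is not 1. *)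
pose t : R := pi / N%:R *+ i.+1.
have -> : 2 * pi / N%:R *+ i.+1 = t *+ 2 by rewrite /t mulrnAC -mulrA mulr_natl.
have s0 : 0 < sin t.
  apply: sin_gt0_pi; rewrite pmulrn_lgt0 // divr_gt0 ?pi_gt0 //=.
  by rewrite /t -mulr_natr mulrAC ltr_pdivrMr // ltr_pM2l ?pi_gt0 // ltr_nat.
apply/orP; left; rewrite cos_mulr2n cos2sin2; apply/negP => /eqP.
have := exprn_gt0 2 s0; lra.
Qed.

Lemma zeta_expN : (zeta ^+ N = 1)%g.
Proof. by apply: val_inj; rewrite [LHS]mu_valX (prim_expr_order zeta_prim). Qed.

Lemma muE (z : mu R N) : exists2 a, (0 < a <= N)%N & z = (zeta ^+ a)%g.
Proof.
have /andP[_ /eqP zN] := muP z.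
have [[[|i] iN] zE] := prim_rootP zeta_prim zN.
  (* Exponent 0 is replaced by [N], since [betti_coproduct_gen] is stated for positive exponents. *)
  exists N; rewrite ?N_gt0 ?leqnn //; apply: val_inj.
  by rewrite [LHS]zE zeta_expN.
exists i.+1; first exact: ltnW.
by apply: val_inj; rewrite [RHS]mu_valX.
Qed.

Lemma fsbig_mu (V : zmodType) (f : mu R N -> V) :
  \sum_(y \in [set: mu R N]) f y = \sum_(1 <= b < N.+1) f (zeta ^+ b)%g.
Proof.
pose r := [seq (zeta ^+ b)%g | b <- index_iota 1 N.+1].
have r_uniq : uniq r.
  rewrite map_inj_in_uniq ?iota_uniq // => b c; rewrite !mem_index_iota.
  move=> bN cN /(congr1 (@mu_val R N)); rewrite !mu_valX => /eqP.
  rewrite (eq_prim_root_expr zeta_prim).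
  (* Modulo [N] the exponent [N] becomes 0, while the others stay unchanged and positive. *)
  have [->|bN'] := eqVneq b N; have [->|cN'] := eqVneq c N => //;
    rewrite ?modnn ?modn_small; lia.
have -> : [set: mu R N]%classic = [set` r]%classic.
  apply/seteqP; split=> // z _ /=; have [a aN ->] := muE z.
  by apply/mapP; exists a => //; rewrite mem_index_iota; lia.
by rewrite -(fsbig_seq _ _ r_uniq) big_map.
Qed.
End RootsOfUnityTheory.

(** * Generators of [W^DR] *)

Section DeRhamGenerators.
Context (k : comPzRingType) (R : realType) (N : nat).
Local Notation mu := (mu R N).
Local Notation VDR := (VDR k R N).
Local Notation WDR := (WDR k R N).
Local Notation dr := (@dr_mu k R N).
Local Notation qd := (qpi (gen_ideal (@dr_rel k R N))).

Lemma dr_mu1 : dr 1%g = 1.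
Proof.
apply: etrans (rmorph1 qd).
apply: (proj2 (qpi_eq (gen_ideal (@dr_rel k R N)) _ _)).
exact/gen_ideal_in/dr_rel_one.
Qed.

Lemma dr_muM (z y : mu) : dr (z * y)%g = dr z * dr y.
Proof.
apply/esym; rewrite /dr_mu -(rmorphM qd); apply/qpi_eq/gen_ideal_in.
by constructor.
Qed.

Lemma dr_muX (z : mu) n : dr (z ^+ n)%g = dr z ^+ n.
Proof.
by elim: n => [|n IH]; [rewrite dr_mu1 | rewrite expgS exprS dr_muM IH].
Qed.

Lemma dr_mu_comm (z : mu) : dr z * e0 k R N = e0 k R N * dr z.
Proof.
pose x : dr_free k R N := dr_var k (inr z); pose y : dr_free k R N := dr_var k (inl false).
have xy : qd (x * y) = qd (y * x) by apply/qpi_eq/gen_ideal_in/dr_rel_comm.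
exact: (etrans (esym (rmorphM qd x y)) (etrans xy (rmorphM qd y x))).
Qed.

(** Up to scalars the elements are the [v * e1], and by linearity [v] may be taken to be a monomial,
    read letter by letter. *)
Lemma WDR_ind (P : WDR -> Prop) :
  (forall c, P c%:S) -> (forall x y, P x -> P y -> P (x + y)) ->
  (forall x y, P x -> P y -> P (x * y)) ->
  (forall n z, P (zW k n.+1 z)) -> forall w, P w.
Proof.
move=> PS PD PM PZ.
pose Q v := P (inS (scal_plus_mul (e1 k R N) v : WDR_sub k R N _)).
have assoc4 (x y z t : VDR) : x * (y * z) * t = x * y * (z * t) by rewrite !mulrA.
have push (x y z t : VDR) : x * y * (z * t) = x * (y * z) * t by rewrite !mulrA.
have pull (x y z t : VDR) : y * z = z * y -> x * y * (z * t) = x * z * y * t.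
  by move=> yz; rewrite push yz !mulrA.
have Q_eq v w : v = w -> Q w -> Q v by move=> ->.
have PE (x y : WDR) : saval x = saval y -> P y -> P x.
  by move=> h; rewrite (val_inj h : x = y).
have PN x : P x -> P (- x).
  by move=> Px; rewrite -mulN1r -(rmorphN1 (@scal k WDR)); apply: PM (PS _) Px.
(* The prefix [e0^n z] absorbs the letters [e0] and [z], which commute, until
   the next [e1] splits off a generator. *)
have Qword w : forall n z, Q (e0 k R N ^+ n * dr z * qd (mon w (1 : k^o))).
  elim: w => [|x w IH] n z.
    apply: (PE _ (- zW k n.+1 z)); last exact/PN/PZ.
    rewrite raddfN /= mulNr opprK; congr (_ * _).
    by rewrite (rmorph1 qd : qd (mon ([::] : word _) (1 : k^o)) = 1) mulr1.
  have -> : qd (mon ((x :: w) : word _) (1 : k^o)) = qd (dr_var k x) * qd (mon w (1 : k^o)).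
    by rewrite -rmorphM /dr_var monM mulr1.
  case: x => [[]|y].
  (* The next letter is [e1]: the prefix followed by it is minus a generator, and the rest of the
     word starts afresh with the trivial prefix. *)
  - pose u := inS (scal_plus_mul (e1 k R N)
      (e0 k R N ^+ 0 * dr 1%g * qd (mon w (1 : k^o))) : WDR_sub k R N _).
    apply: (PE _ (- zW k n.+1 z * u)); last by apply: PM; [apply/PN/PZ | apply: IH].
    rewrite rmorphM raddfN /= !mulNr opprK expr0 dr_mu1 !mul1r.
    exact: assoc4.
  - have -> : qd (dr_var k (inl false)) = e0 k R N by [].
    by apply: Q_eq (IH n.+1 z); rewrite exprSr; apply/pull/dr_mu_comm.
  by apply: Q_eq (IH n (z * y)%g); rewrite dr_muM; apply: push.
have QD v w : Q v -> Q w -> Q (v + w).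
  move=> Qv Qw; apply: PE (PD _ _ Qv Qw).
  by rewrite raddfD /= mulrDl.
have QS c v : Q v -> Q (c%:S * v).
  by move=> Qv; apply: PE (PM _ _ (PS c) Qv); rewrite rmorphM /= mulrA.
have QA v : Q v.
  elim/(@qpi_ind k _ (gen_ideal (@dr_rel k R N))): v => f.
  elim/(@monalg_ind (word (dr_gen R N)) k^o): f => [|f g Qf Qg|w c].
  - by apply: PE (PS 0); rewrite /= !raddf0 mul0r.
  - by rewrite raddfD; apply: QD.
  apply: (Q_eq _ ((c : k)%:S * (e0 k R N ^+ 0 * dr 1%g * qd (mon w (1 : k^o))))).
    rewrite expr0 dr_mu1 !mul1r -[RHS](rmorphM qd (c : k)%:S).
    by rewrite scal_mon /= mulr1.
  exact: QS.
move=> w; have [c [v wE]] := savalP w.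
by apply: PE (PD _ _ (PS c) (QA v)); rewrite wE raddfD.
Qed.
End DeRhamGenerators.

(** * Powers in a filtered algebra *)

Section FiltrationPowers.
Context {k : comPzRingType} {A : pzAlgType k} (F : filtration A).

Lemma filX m (x : A) n : F m x -> F (m *+ n) (x ^+ n).
Proof.
move=> Fx; elim: n => [|n IH]; first exact: fil_one.
by rewrite exprS mulrS; apply: filM.
Qed.

Lemma clsX m (x : A) n : F m x -> cls F m x ^+ n = cls F (m *+ n) (x ^+ n).
Proof.
move=> Fx; elim: n => [|n IH]; first by rewrite expr0 mulr0n cls1.
by rewrite !exprS mulrS IH clsM //; apply: filX.
Qed.
End FiltrationPowers.

(** Positivity matters: for [a = 0] the summation convention gives [- f 0], not an empty sum. *)
Lemma sumz1 (V : zmodType) (a : nat) (f : int -> V) : (0 < a)%N ->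
  sumz 1 (a%:Z - 1) f = \sum_(1 <= b < a) f b%:Z.
Proof.
case: a => // a _; have -> : a.+1%:Z - 1 = a%:Z by lia.
rewrite /sumz subrr lez_nat leq0n subr0 absz_nat.
by rewrite big_add1 big_mkord; apply: eq_bigr => i _; rewrite intS.
Qed.

(** * Difference recursion for the convolution *)

Section Convolution.
Context {U V : zmodType} (t : U -> U -> V) (N : nat) (u : nat -> nat -> U).
Hypothesis tBl : forall x x' y, t (x - x') y = t x y - t x' y.
Hypothesis tBr : forall x y y', t x (y - y') = t x y - t x y'.
Hypothesis uS : forall n a, u n.+1 a = u n (N + a)%N - u n a.

(* Encoding [t (u n a) (u m b)] as [(x^N - 1)^n x^a (y^N - 1)^m y^b], this is the
   value at [f = (t^N - 1)^n t^a] of [(y f(x) - x f(y)) / (x - y)], the linear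
   map which sends [t^m] to [\sum_(1 <= b < m) x^b y^(m - b)]. *)
Definition conv n a := \sum_(1 <= b < a) t (u n b) (u 0%N (a - b)%N) +
  \sum_(j < n) \sum_(1 <= b < N.+1) t (u j b) (u (n.-1 - j)%N (N + a - b)%N).

(** Cut the sum up to [N + a] after [b = N]. The initial block is the new row [j = n]; in the
    remainder, shifting [b] by [N] and subtracting raises the index of the left factor by [uS]. In
    the rows [j < n] the difference is taken in the right factor instead. *)
Lemma convS n a : (0 < a)%N -> conv n.+1 a = conv n (N + a) - conv n a.
Proof.
move=> a_gt0; rewrite /conv opprD addrACA.
set s := \sum_(1 <= b < N.+1) t (u n b) (u 0%N (N + a - b)%N).
rewrite big_ord_recr /= subnn -/s.
have -> : \sum_(1 <= b < N + a) t (u n b) (u 0 (N + a - b)) -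
    \sum_(1 <= b < a) t (u n b) (u 0 (a - b)) =
    s + \sum_(1 <= b < a) t (u n.+1 b) (u 0 (a - b)).
  rewrite (big_cat_nat (n := N.+1)) //=; last lia.
  rewrite -/s -addrA; congr (s + _).
  rewrite -[in X in X - _](add1n N) big_addn (_ : N + a - N = a)%N; last lia.
  rewrite -sumrB; apply: eq_bigr => b _; rewrite uS tBl addnC.
  by congr (t _ (u _ _) - _); lia.
rewrite -addrA addrCA; congr (_ + _); rewrite [LHS]addrC; congr (s + _).
rewrite -sumrB; apply: eq_bigr => j _; rewrite -sumrB !big_nat.
apply: eq_bigr => b bN; rewrite -tBr.
have -> : (n - j = (n.-1 - j).+1)%N by have := ltn_ord j; lia.
by rewrite uS; congr (t _ (u _ _ - _)); lia.
Qed.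
End Convolution.

(** * Betti lifts of the de Rham generators *)

Section BettiGenerators.
Context (k : comPzRingType) (N : nat).
Local Notation g a := (grp k (X0 ^+ a)%g).

Definition betti_gen (n a : nat) : WB k :=
  inS (scal_plus_mul (grp k X1 - 1) ((g N - 1) ^+ n * g a) : WB_sub k _).

Lemma betti_gen0 a : betti_gen 0 a = X0nX1 k a%:Z.
Proof. by apply: val_inj; rewrite /= mul1r. Qed.

Lemma betti_genS n a : betti_gen n.+1 a = betti_gen n (N + a) - betti_gen n a.
Proof.
apply: val_inj; rewrite [RHS]raddfB /= -mulrBl -mulrBr exprSr -mulrA mulrBl mul1r.
by rewrite /grp monM mulr1 expgnDr.
Qed.

(** The [n] factors [X_0^N - 1] and the factor [X_1 - 1] lie in [I_N], while [X_0^a] has degree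
    0. *)
Lemma betti_gen_fil (R : realType) n a : WB_fil k R N n.+1%:Z (betti_gen n a).
Proof.
have g0 : VB_fil k R N 0 (g a) by [].
rewrite (_ : n.+1%:Z = 1 *+ n + 0 + 1); last by rewrite natz; lia.
exact: (filM (filM (filX n (X0N_sub1_in_fil1 k R N)) g0) (X1_sub1_in_fil1 k R N)).
Qed.

(** Both sides satisfy the same recursion in [n], by [betti_genS] and [convS]; for [n = 0] the
    formula is the one defining the coproduct. As the recursion shifts [a] by [N], the induction is
    uniform in [a]. *)
Lemma betti_coproduct_gen (D : WB k -> WB k \otimes WB k) n a :
  zmod_morphism D -> is_betti_coproduct D -> (0 < a)%N ->
  D (betti_gen n a) = betti_gen n a \otimes 1 + 1 \otimes betti_gen n a -
    conv (@tpure k (WB k) (WB k)) N betti_gen n a.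
Proof.
move=> DB [_ DX]; elim: n a => [|n IH] a a_gt0.
  rewrite /conv big_ord0 addr0 betti_gen0 DX sumz1 //; congr (_ - _).
  rewrite !big_nat; apply: eq_bigr => b /andP[_ ba].
  by rewrite tpureM mul1r mulr1 !betti_gen0 subzn // ltnW.
rewrite {1}betti_genS DB (IH _ a_gt0) IH ?addn_gt0 ?a_gt0 ?orbT //.
rewrite convS //; [|exact: tpureBl|exact: tpureBr|exact: betti_genS].
rewrite betti_genS tpureBl tpureBr.
move: (conv _ _ _ _ _) (conv _ _ _ _ _) => c c'.
move: (_ \otimes _) (_ \otimes _) (_ \otimes _) (_ \otimes _) => w x y z.
by rewrite !opprD [LHS]addrACA; congr (_ + _); apply: addrACA.
Qed.
End BettiGenerators.

(** * Comparison of the coproducts on generators *)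

Section Comparison.
Context (k : comPzRingType) (R : realType) (N : nat).
Local Notation VBf := (VB_fil k R N).
Local Notation WBf := (WB_fil k R N).
Context (rhoV : {alghom VDR k R N -> gr VBf}) (rhoV_spec : is_rhoV rhoV).
Context (rhoW : {alghom WDR k R N -> gr WBf}) (rhoW_spec : is_rhoW rhoV rhoW).

Lemma rhoW_zW n a :
  rhoW (zW k n.+1 (zeta R N ^+ a)%g) = - cls WBf n.+1%:Z (betti_gen k N n a).
Proof.
have [_ _ rz r0 r1] := rhoV_spec.
(* Compute in [gr VB], where [rhoW] is known through [rhoV]; this loses nothing as the inclusion is
   strict. *)
apply: (@gr_map_inj k (WB k) (VB k) WBf VBf saval) => //.
have FX1 := X1_sub1_in_fil1 k R N; have FX0 := X0N_sub1_in_fil1 k R N.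
have F0 x : VBf 0 x by [].
have grX b : grp k X0 ^+ b = grp k (X0 ^+ b)%g.
  elim: b => [|b IH]; first by rewrite expr0 expg0.
  by rewrite exprS IH /grp monM mulr1 -expgS.
have vE : saval (zW k n.+1 (zeta R N ^+ a)%g) =
    - (e0 k R N ^+ n * dr_mu k (zeta R N) ^+ a * e1 k R N).
  by rewrite /= mulNr dr_muX.
have rhoVE (x y z : VDR k R N) : rhoV (- (x ^+ n * y ^+ a * z)) =
    - (rhoV x ^+ n * rhoV y ^+ a * rhoV z) by rewrite rmorphN !rmorphM !rmorphXn.
rewrite rhoW_spec vE rhoVE rz r0 r1.
rewrite (clsX n FX0) (clsX a (F0 _)) (clsM (filX n FX0) (filX a (F0 _))).
rewrite (clsM (filM (filX n FX0) (filX a (F0 _))) FX1).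
have WF := betti_gen_fil k N R n a.
have sF : filtered_map WBf VBf (saval : WB k -> VB k) by [].
rewrite (zmod_morphismN (gr_mapB sF)).
rewrite (gr_map_cls sF WF); congr (- cls _ _ _).
  by rewrite mul0rn natz; lia.
by rewrite grX.
Qed.

Local Notation T := (tens_fil WBf WBf).
Local Notation u := (betti_gen k N).
Local Notation z n a := (zW k n (zeta R N ^+ a)%g).

(** The right vertical arrow, landing in [gr] of the tensor square. *)
Let rhoT t := gr_tens WBf WBf (tens_map rhoW rhoW t).

Let rhoTB : zmod_morphism rhoT.
Proof. by move=> x y; rewrite /rhoT tens_mapB gr_tensB. Qed.

Let rhoT_tens x y p q : rhoW x = p -> rhoW y = q ->
  rhoT (x \otimes y) = gr_tens WBf WBf (p \otimes q).
Proof. by move=> <- <-; rewrite /rhoT tens_map_pure. Qed.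

(** The signs of the two factors cancel here, whereas [rhoT_l] and [rhoT_r] keep one: this
    reconciles the minus sign in the Betti coproduct with the plus sign in the de Rham one. *)
Let rhoT_pure n a m b :
  rhoT (z n.+1 a \otimes z m.+1 b) = cls T (n.+1%:Z + m.+1%:Z) (u n a \otimes u m b).
Proof.
rewrite (rhoT_tens (rhoW_zW n a) (rhoW_zW m b)) tpureNl tpureNr opprK.
by apply: gr_tens_pure; apply: betti_gen_fil.
Qed.

Let rhoW1 : rhoW 1 = cls WBf 0 1.
Proof. by rewrite cls1 rmorph1. Qed.

Let rhoT_l n a : rhoT (z n.+1 a \otimes 1) = - cls T n.+1%:Z (u n a \otimes 1).
Proof.
rewrite (rhoT_tens (rhoW_zW n a) rhoW1) tpureNl (zmod_morphismN (@gr_tensB k _ _ WBf WBf)).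
rewrite -[in RHS](addr0 n.+1%:Z); congr (- _); apply: gr_tens_pure.
  exact: betti_gen_fil.
exact: fil_one.
Qed.

Let rhoT_r n a : rhoT (1 \otimes z n.+1 a) = - cls T n.+1%:Z (1 \otimes u n a).
Proof.
rewrite (rhoT_tens rhoW1 (rhoW_zW n a)) tpureNr (zmod_morphismN (@gr_tensB k _ _ WBf WBf)).
rewrite -[in RHS](add0r n.+1%:Z); congr (- _); apply: gr_tens_pure.
  exact: fil_one.
exact: betti_gen_fil.
Qed.

Lemma coproduct_zW (DeltaB : {alghom WB k -> (WB k \otimes WB k)%type})
    (DeltaDR : {alghom WDR k R N -> (WDR k R N \otimes WDR k R N)%type}) n a :
  is_betti_coproduct DeltaB -> filtered_map WBf T DeltaB ->
  is_dr_coproduct DeltaDR -> (0 < a <= N)%N ->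
  gr_map T DeltaB (rhoW (z n.+1 a)) = rhoT (DeltaDR (z n.+1 a)).
Proof.
move=> DB_spec DB_fil DDR_spec /andP[a_gt0 aN]; have N_gt0 := leq_trans a_gt0 aN.
have WF m b := betti_gen_fil k N R m b.
have TF m b m' b' : T (m.+1%:Z + m'.+1%:Z) (u m b \otimes u m' b').
  exact: tens_fil_pure.
(* The degrees [j + 1] and [n - j] add up to [n + 1]. *)
have TF2 (j : 'I_n) b b' : T n.+1%:Z (u j b \otimes u (n.-1 - j)%N b').
  have := TF j b (n.-1 - j)%N b'; congr (fil _ _ _); have := ltn_ord j; lia.
have TFl : T n.+1%:Z (u n a \otimes 1).
  by rewrite -[n.+1%:Z]addr0; apply: tens_fil_pure => //; apply: fil_one.
have TFr : T n.+1%:Z (1 \otimes u n a).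
  by rewrite -[n.+1%:Z]add0r; apply: tens_fil_pure => //; apply: fil_one.
(* Here the degrees [n + 1] and 1 exceed [n + 1] in total, so this sum disappears from the class. *)
have TF1 : T (n.+1%:Z + 1) (\sum_(1 <= b < a) u n b \otimes u 0 (a - b)).
  by apply: fil_sum => b _; apply: TF.
have TF3 : T n.+1%:Z (\sum_(j < n) \sum_(1 <= b < N.+1) u j b \otimes u (n.-1 - j) (N + a - b)).
  by apply: fil_sum => j _; apply: fil_sum => b _; apply: TF2.
have -> : gr_map T DeltaB (rhoW (z n.+1 a)) = - cls T n.+1%:Z (DeltaB (u n a)).
  by rewrite rhoW_zW (zmod_morphismN (gr_mapB DB_fil)) gr_map_cls.
have -> : cls T n.+1%:Z (DeltaB (u n a)) =
    cls T n.+1%:Z (u n a \otimes 1) + cls T n.+1%:Z (1 \otimes u n a) -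
    \sum_(j < n) \sum_(1 <= b < N.+1)
      cls T n.+1%:Z (u j b \otimes u (n.-1 - j) (N + a - b)).
  rewrite betti_coproduct_gen //; last exact: raddfB.
  rewrite /conv (clsB (filD TFl TFr) (filD (fil_decr TF1) TF3)).
  rewrite (clsD TFl TFr) (clsD (fil_decr TF1) TF3).
  rewrite (proj2 (cls_eq0 (fil_decr TF1)) TF1) add0r; congr (_ - _).
  rewrite cls_sum; last by move=> j _; apply: fil_sum => b _; apply: TF2.
  by apply: eq_bigr => j _; apply: cls_sum => b _; apply: TF2.
have rhoTD3 x y t : rhoT (x + y + t) = rhoT x + rhoT y + rhoT t.
  by rewrite !(zmod_morphismD rhoTB).
rewrite (DDR_spec n.+1 _ (ltn0Sn n)) rhoTD3.
have ES : rhoT (\sum_(1 <= j < n.+1) \sum_(y \in [set: mu R N])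
      zW k j y \otimes zW k (n.+1 - j) (zeta R N ^+ a * y^-1)%g) =
    \sum_(j < n) \sum_(1 <= b < N.+1)
      cls T n.+1%:Z (u j b \otimes u (n.-1 - j) (N + a - b)).
  rewrite (zmod_morphism_sum rhoTB) big_add1 big_mkord; apply: eq_bigr => -[j /= jn] _.
  rewrite fsbig_mu // (zmod_morphism_sum rhoTB) !big_nat; apply: eq_bigr => b bN.
  (* Adding [N] makes [N + a - b] a true subtraction for [b <= N], and changes nothing as
     [zeta_N^N = 1]. *)
  have -> : (zeta R N ^+ a * (zeta R N ^+ b)^-1 = zeta R N ^+ (N + a - b))%g.
    rewrite -[RHS](mulgK (zeta R N ^+ b)%g) -expgnDr subnK ?expgnDr; last lia.
    by rewrite zeta_expN // mul1g.
  have -> : (n.+1 - j.+1 = (n.-1 - j).+1)%N by lia.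
  by rewrite rhoT_pure; congr (cls _ _ _); lia.
apply: esym; apply: etrans (f_equal2 +%R (f_equal2 +%R (rhoT_l n a) (rhoT_r n a)) ES) _.
by rewrite opprB [RHS]addrC opprD.
Qed.
End Comparison.

(** * Extension from generators to the whole algebra *)

Theorem theorem1p6 (k : comPzRingType) (Q_alg : {rmorphism rat -> k})
    (R : realType) (N : nat) (N_gt0 : (0 < N)%N)
    (DeltaB : {alghom WB k -> (WB k \otimes WB k)%type})
    (DeltaB_spec : is_betti_coproduct DeltaB)
    (DeltaB_filtered : filtered_map (WB_fil k R N)
       (tens_fil (WB_fil k R N) (WB_fil k R N)) DeltaB)
    (DeltaDR : {alghom WDR k R N -> (WDR k R N \otimes WDR k R N)%type})
    (DeltaDR_spec : is_dr_coproduct DeltaDR)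
    (rhoV : {alghom VDR k R N -> gr (VB_fil k R N)})
    (rhoV_spec : is_rhoV rhoV)
    (rhoW : {alghom WDR k R N -> gr (WB_fil k R N)})
    (rhoW_spec : is_rhoW rhoV rhoW) :
  gr_map (tens_fil (WB_fil k R N) (WB_fil k R N)) DeltaB \o rhoW =1
  gr_tens (WB_fil k R N) (WB_fil k R N) \o
    tens_map rhoW rhoW \o DeltaDR.
Proof.
move=> w.
set T := tens_fil _ _.
pose L w := gr_map T DeltaB (rhoW w).
pose M w := gr_tens (WB_fil k R N) (WB_fil k R N) (tens_map rhoW rhoW (DeltaDR w)).
have LD x y : L (x + y) = L x + L y.
  by rewrite /L raddfD (zmod_morphismD (gr_mapB DeltaB_filtered)).
have LM x y : L (x * y) = L x * L y.
  by rewrite /L rmorphM (gr_mapM DeltaB_filtered).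
have LS c : L c%:S = c%:S by rewrite /L ahom_scal (gr_map_scal DeltaB_filtered).
have MD x y : M (x + y) = M x + M y.
  by rewrite /M raddfD (zmod_morphismD (@tens_mapB k _ _ _ _ rhoW rhoW))
    (zmod_morphismD (@gr_tensB k _ _ _ _)).
have MM x y : M (x * y) = M x * M y.
  by rewrite /M rmorphM tens_mapM gr_tensM.
have MS c : M c%:S = c%:S by rewrite /M ahom_scal tens_map_scal gr_tens_scal.
have LMz n z : L (zW k n.+1 z) = M (zW k n.+1 z).
  have [a aN ->] := muE N_gt0 z.
  exact: (coproduct_zW rhoV_spec rhoW_spec n DeltaB_spec DeltaB_filtered DeltaDR_spec aN).
suff : L w = M w by [].
clearbody L M.
elim/WDR_ind: w => [c|x y Ex Ey|x y Ex Ey|n z].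
- by rewrite LS MS.
- by rewrite LD MD Ex Ey.
- by rewrite LM MM Ex Ey.
exact: LMz.
Qed.
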